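(* Let $f$ be a pseudo-polynomial. There exist an exponent $\eta>0$ and a constant $C>0$, both depending only on $f$, such that for every real number $\xi$ and every sufficiently large $N\in\mathbb{N}$, \[\min_{1\le n\le N}\lVert\xi\lfloor f(n)\rfloor\rVert\le C N^{-\eta}.\]
   Context: A pseudo-polynomial is a function $f(x)=\alpha_1x^{\theta_1}+\cdots+\alpha_dx^{\theta_d}$ where $\alpha_1,\dots,\alpha_d,\theta_1,\dots,\theta_d$ are positive reals with $1\le\theta_1<\cdots<\theta_d$ and at least one $\theta_j\notin\mathbb{Z}$. $\lVert x\rVert$ denotes the distance from $x$ to the nearest integer, and $\lfloor\cdot\rfloor$ the floor function. *)

(* Defs.v *)
From Stdlib Require Import Reals.
Open Scope R_scope.

(* Floor function: Stdlib's Int_part r = up r - 1 is the greatest integer <= r. *)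
Definition rfloor (x : R) : R := IZR (Int_part x).

Definition dist_nint (x : R) : R := Rmin (x - rfloor x) (rfloor x + 1 - x).

Definition is_pseudo_poly (d : nat) (alpha theta : nat -> R) : Prop :=
  (1 <= d)%nat /\
  (forall i, (i < d)%nat -> 0 < alpha i) /\
  (forall i, (i < d)%nat -> 0 < theta i) /\
  1 <= theta 0%nat /\
  (forall i j, (i < j)%nat -> (j < d)%nat -> theta i < theta j) /\
  (exists j, (j < d)%nat /\ ~ (exists z : Z, theta j = IZR z)).

(* f(x) = sum_{i<d} alpha_i x^{theta_i}, for x > 0. *)
Fixpoint pseudo_poly (d : nat) (alpha theta : nat -> R) (x : R) : R :=
  match d with
  | O => 0
  | S k => pseudo_poly k alpha theta x + alpha k * Rpower x (theta k)
  end.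

(* Main.v *)
Require Import Defs.
From Stdlib Require Import Reals Lra Lia List Classical ZArith.
Import ListNotations.
Open Scope R_scope.

(** Let [T > 1] be the largest non-integer exponent of [f] and [D] an integer above all exponents.
    The derivative of order [D + 1] kills every integer power, so it has exact order [x^(T - D - 1)].
    Weyl-van der Corput differencing [D] times with shifts of size about [P^((D + 1/2 - T) / D)]
    turns [beta f] into a phase whose increments have size about [P^(-1/2)], and the Kusmin-Landau
    inequality gives a power saving in [sum_(P <= n < 2P) e(beta f(n))] for all
    [P^(-kap) <= |beta| <= P^kap].

    Given [xi] and [P = N / 2], there are two cases. If [|u xi + v| >= P^(-kap)] for all small
    [(u, v) <> 0], then [(xi f(n), f(n))] is so well distributed modulo 1 that for some [n] the number
    [xi f(n)] is close to an integer and [f(n)] lies just above one, so [xi floor(f(n))] is close to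
    an integer.
    Otherwise [q xi] is within [P^(-kap)] of an integer for some small [q]; at the much smaller scale
    [W = P^sc] the same exponential sums produce [n] with [q | floor(f(n))], and
    [P^(-kap) f(n)] is still small. *)

(** The largest exponent may be an integer with an arbitrary coefficient, so the sizes must be
    governed by [T] and not by the degree. The shift size is a balance: [D] shifts multiply a
    derivative of size [P^(T - D - 1)] into increments [lam] of size [P^(-1/2)] with second
    differences [mu] of size [P^(-3/2)], so that both Kusmin-Landau terms [1 / lam] and
    [P mu / lam^2] are about [P^(1/2)]. The condition [T > 1] keeps these shifts shorter than [P],
    and [T < D] keeps them longer than a power of [P].

    The floor is not smooth: [xi floor(f(n))] differs from [xi f(n)] by [xi] times the fractional
    part of [f(n)], which forces control of two coordinates at once. A case distinction is needed
    because [xi] may be rational or very well approximable, and then the two coordinates are not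
    independent. The exponent [eta] is fixed before [xi]; the size of [xi] enters only through the
    threshold on [N]. *)

(** * Finite sums and Cauchy-Schwarz *)

Fixpoint rsum (n : nat) (u : nat -> R) : R :=
  match n with O => 0 | S k => rsum k u + u k end.

Lemma rsum_ext n u v : (forall i, (i < n)%nat -> u i = v i) -> rsum n u = rsum n v.
Proof.
  induction n as [|n IH]; intros H; simpl; [reflexivity|].
  rewrite IH, H; [reflexivity|lia|intros; apply H; lia].
Qed.

Lemma rsum_le n u v : (forall i, (i < n)%nat -> u i <= v i) -> rsum n u <= rsum n v.
Proof.
  induction n as [|n IH]; intros H; simpl; [lra|].
  apply Rplus_le_compat; [apply IH; intros; apply H|apply H]; lia.
Qed.

Lemma rsum_const n c : rsum n (fun _ => c) = INR n * c.
Proof. induction n as [|n IH]; [simpl; ring|]. simpl rsum. rewrite IH, S_INR; ring. Qed.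

Lemma rsum_plus n u v : rsum n (fun i => u i + v i) = rsum n u + rsum n v.
Proof. induction n as [|n IH]; simpl; [ring|rewrite IH; ring]. Qed.

Lemma rsum_scal n c u : rsum n (fun i => c * u i) = c * rsum n u.
Proof. induction n as [|n IH]; simpl; [ring|rewrite IH; ring]. Qed.

Lemma rsum_exchange n m (u : nat -> nat -> R) :
  rsum n (fun i => rsum m (u i)) = rsum m (fun j => rsum n (fun i => u i j)).
Proof.
  induction n as [|n IH]; simpl; [rewrite rsum_const; ring|].
  rewrite IH, rsum_plus; reflexivity.
Qed.

Lemma rsum_le_const n u c : (forall i, (i < n)%nat -> u i <= c) -> rsum n u <= INR n * c.
Proof. intros H; rewrite <- rsum_const; apply rsum_le; exact H. Qed.

Lemma rsum_nonneg n u : (forall i, (i < n)%nat -> 0 <= u i) -> 0 <= rsum n u.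
Proof.
  intros H; replace 0 with (rsum n (fun _ => 0)) by (rewrite rsum_const; ring).
  apply rsum_le; exact H.
Qed.

Lemma rsum_app n m u : rsum (n + m) u = rsum n u + rsum m (fun i => u (n + i)%nat).
Proof.
  induction m as [|m IH]; simpl; [rewrite Nat.add_0_r; ring|].
  rewrite Nat.add_succ_r; simpl; rewrite IH; ring.
Qed.

Lemma rsum_mul n m u v : rsum n u * rsum m v = rsum n (fun i => rsum m (fun j => u i * v j)).
Proof.
  rewrite Rmult_comm, <- rsum_scal; apply rsum_ext; intros i _.
  rewrite rsum_scal; ring.
Qed.

Lemma rsum_cauchy_schwarz n u : (rsum n u)² <= INR n * rsum n (fun i => (u i)²).
Proof.
  induction n as [|n IH]; [simpl; unfold Rsqr; lra|].
  simpl rsum; rewrite S_INR.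
  set (s := rsum n u) in *; set (t := rsum n (fun i => (u i)²)) in *.
  assert (Hn := pos_INR n); set (k := INR n) in *; set (x := u n).
  (* For [k > 0] this is [(s - k * x)² >= 0] combined with [s² <= k * t] and divided by [k]; for
     [k = 0] the induction hypothesis forces [s = 0]. *)
  assert (H : 2 * s * x <= t + k * x²).
  { destruct (Req_dec k 0) as [E|E].
    - assert (s = 0).
      { apply Rsqr_0_uniq, Rle_antisym; [|apply Rle_0_sqr]. rewrite E in IH; lra. }
      assert (0 <= t) by (apply rsum_nonneg; intros; apply Rle_0_sqr).
      rewrite H, E; lra.
    - assert (0 < k) by lra.
      assert (0 <= (s - k * x)²) by apply Rle_0_sqr.
      apply Rmult_le_reg_l with k; [assumption|].
      unfold Rsqr in *; nra. }
  unfold Rsqr in *; nra.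
Qed.

(* The squared modulus of [sum e^(i x_h)], written without complex numbers. *)
Lemma rsum_cos_sin_sqr n x :
  (rsum n (fun i => cos (x i)))² + (rsum n (fun i => sin (x i)))²
  = rsum n (fun i => rsum n (fun j => cos (x i - x j))).
Proof.
  unfold Rsqr; rewrite !rsum_mul, <- rsum_plus; apply rsum_ext; intros i _.
  rewrite <- rsum_plus; apply rsum_ext; intros j _.
  rewrite cos_minus; reflexivity.
Qed.

(** * Trigonometric bounds and the Kusmin-Landau inequality *)

(** The Taylor polynomial of degree 7 is a lower bound for [sin], and on this range its terms beyond
    the first are controlled by [x^3 <= x] and [x^7 <= x^5]. *)
Lemma sin_lower x : 0 <= x <= 1 -> x / 2 <= sin x.
Proof.
  intros [H0 H1].
  destruct (Req_dec x 0) as [->|Hx]; [rewrite sin_0; lra|].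
  assert (HP := PI2_3_2).
  destruct (SIN x) as [H _]; [lra|lra|].
  unfold sin_lb, sin_approx, sin_term in H; simpl in H.
  unfold INR in H; simpl in H.
  assert (x*x <= 1) by nra.
  assert (0 <= x * (x*x) * (x*x)) by (repeat apply Rmult_le_pos; lra).
  assert (0 <= x * (x*x) ) by (repeat apply Rmult_le_pos; lra).
  assert (x * (x*x) * (x*x)*(x*x) <= x * (x*x) * (x*x) ) by nra.
  assert (x * (x*x) <= x) by nra.
  lra.
Qed.

Lemma Rabs_le_elim x y : Rabs x <= y -> - y <= x <= y.
Proof.
  intros H; pose proof (Rle_abs x); pose proof (Rle_abs (- x)).
  rewrite Rabs_Ropp in *; lra.
Qed.

Lemma Rabs_cos_le x : Rabs (cos x) <= 1.
Proof. destruct (COS_bound x); apply Rabs_le; lra. Qed.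
Lemma Rabs_sin_le x : Rabs (sin x) <= 1.
Proof. destruct (SIN_bound x); apply Rabs_le; lra. Qed.

Lemma sin_abs_le x : Rabs (sin x) <= Rabs x.
Proof.
  assert (H : forall y, 0 <= y -> Rabs (sin y) <= y).
  { intros y [Hy|<-]; [|rewrite sin_0, Rabs_R0; lra].
    destruct (Rle_dec y PI) as [Hp|Hp].
    - rewrite Rabs_right; [left; apply sin_lt_x; lra|apply Rle_ge, sin_ge_0; lra].
    - assert (H2 := PI2_3_2). assert (H1 := Rabs_sin_le y). lra. }
  destruct (Rle_dec 0 x).
  - rewrite (Rabs_right x) by lra; apply H; assumption.
  - rewrite <- Rabs_Ropp, <- sin_neg, (Rabs_left x) by lra. apply H; lra.
Qed.

(** Summation by parts moves the differences from [s] to [q]: each of the two boundary terms costs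
    [A], and each remaining term costs [B]. *)
Lemma abel_bound n (q s : nat -> R) (A B : R) :
  (forall i, Rabs (s i) <= 1) ->
  (forall i, (i <= n)%nat -> Rabs (q i) <= A) ->
  (forall i, (i < n)%nat -> Rabs (q (S i) - q i) <= B) ->
  Rabs (rsum n (fun i => q i * (s (S i) - s i))) <= 2 * A + INR n * B.
Proof.
  intros Hs Hq Hd.
  assert (E : rsum n (fun i => q i * (s (S i) - s i))
    = q n * s n - q 0%nat * s 0%nat - rsum n (fun i => (q (S i) - q i) * s (S i))).
  { clear; induction n as [|n IH]; simpl; [ring|rewrite IH; ring]. }
  rewrite E.
  assert (H1 : forall i x, (i <= n)%nat -> Rabs x <= 1 -> Rabs (q i * x) <= A).
  { intros i x Hi Hx; rewrite Rabs_mult. specialize (Hq i Hi).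
    assert (0 <= Rabs x) by apply Rabs_pos; assert (0 <= Rabs (q i)) by apply Rabs_pos; nra. }
  assert (H2 : Rabs (rsum n (fun i => (q (S i) - q i) * s (S i))) <= INR n * B).
  { assert (H3 : forall m v C, (forall i, (i < m)%nat -> Rabs (v i) <= C) ->
      Rabs (rsum m v) <= INR m * C).
    { intros m v C; induction m as [|m IH]; intros H; [simpl; rewrite Rabs_R0; lra|].
      simpl rsum; rewrite S_INR; eapply Rle_trans; [apply Rabs_triang|].
      assert (Rabs (v m) <= C) by (apply H; lia).
      assert (Rabs (rsum m v) <= INR m * C) by (apply IH; intros; apply H; lia). lra. }
    apply H3; intros i Hi; rewrite Rabs_mult.
    specialize (Hd i Hi); specialize (Hs (S i)).
    assert (0 <= Rabs (q (S i) - q i)) by apply Rabs_pos.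
    assert (0 <= Rabs (s (S i))) by apply Rabs_pos. nra. }
  pose proof (H1 n (s n) (le_n n) (Hs n)).
  pose proof (H1 0%nat (s 0%nat) (Nat.le_0_l n) (Hs 0%nat)).
  unfold Rminus; eapply Rle_trans; [apply Rabs_triang|].
  rewrite Rabs_Ropp.
  apply Rplus_le_compat; [|exact H2].
  eapply Rle_trans; [apply Rabs_triang|]. rewrite Rabs_Ropp; lra.
Qed.

(* Multiplying [e^(iG)] by [1 = (e^(i delta) - 1) / (e^(i delta) - 1)] makes the sum telescope up to
   the variation of [cot (delta / 2)]. *)
Lemma kusmin_landau (m : nat) (G : nat -> R) (c lam mu : R) :
  0 < lam ->
  (forall i, (i <= m)%nat -> lam <= G (S i) - G i <= 1) ->
  (forall i, (i < m)%nat -> Rabs ((G (S (S i)) - G (S i)) - (G (S i) - G i)) <= mu) ->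
  rsum m (fun i => cos (G i + c)) <= 1 + 4 / lam + INR m * (4 * mu / (lam * lam)).
Proof.
  intros Hl Hd Hm.
  set (dl := fun i => (G (S i) - G i) / 2).
  set (q := fun i => cos (dl i) / sin (dl i)).
  assert (Hsin : forall i, (i <= m)%nat -> lam / 4 <= sin (dl i)).
  { intros i Hi; specialize (Hd i Hi). apply Rle_trans with (dl i / 2); unfold dl; [lra|].
    apply sin_lower; lra. }
  (* Real part of the telescoping identity, from [1 / (e^(2i delta) - 1) = -1/2 - (i/2) cot delta]
     with [delta = dl i]; [q] is the cotangent. *)
  assert (E : forall i, (i < m)%nat -> cos (G i + c) =
     - / 2 * (cos (G (S i) + c) - cos (G i + c))
     + / 2 * (q i * (sin (G (S i) + c) - sin (G i + c)))).
  { intros i Hi.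
    assert (Hs : sin (dl i) <> 0) by (specialize (Hsin i ltac:(lia)); lra).
    replace (G (S i) + c) with ((G i + c) + 2 * dl i) by (unfold dl; field).
    generalize (G i + c) as g; intros g.
    rewrite cos_plus, sin_plus, cos_2a_sin, sin_2a; unfold q.
    generalize (sin2_cos2 (dl i)); unfold Rsqr; intros H.
    transitivity (cos g * (sin (dl i) * sin (dl i) + cos (dl i) * cos (dl i))).
    - rewrite H; ring.
    - field; exact Hs. }
  rewrite (rsum_ext _ _ _ E), rsum_plus, !rsum_scal.
  assert (H1 : rsum m (fun i => cos (G (S i) + c) - cos (G i + c)) = cos (G m + c) - cos (G 0%nat + c)).
  { clear; induction m as [|m IH]; simpl; [ring|rewrite IH; ring]. }
  rewrite H1.
  assert (H2 := abel_bound m q (fun i => sin (G i + c)) (4 / lam) (8 * mu / (lam * lam))).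
  assert (H3 : Rabs (rsum m (fun i => q i * (sin (G (S i) + c) - sin (G i + c))))
     <= 2 * (4 / lam) + INR m * (8 * mu / (lam * lam))).
  { apply H2.
    - intros; apply Rabs_sin_le.
    - intros i Hi; unfold q, Rdiv; rewrite Rabs_mult.
      specialize (Hsin i Hi). rewrite (Rabs_right (/ sin (dl i))).
      2:{ apply Rle_ge; left; apply Rinv_0_lt_compat; lra. }
      assert (/ sin (dl i) <= / (lam / 4)) by (apply Rinv_le_contravar; lra).
      replace (4 * / lam) with (1 * / (lam / 4)) by (field; lra).
      apply Rmult_le_compat; try apply Rabs_pos; [|apply Rabs_cos_le|assumption].
      left; apply Rinv_0_lt_compat; lra.
    - intros i Hi.
      pose proof (Hsin i ltac:(lia)) as Ha; pose proof (Hsin (S i) ltac:(lia)) as Hb.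
      (* Difference formula for the cotangent. The half-angles differ by at most [mu / 2] and both
         sines are at least [lam / 4], whence [8 * mu / lam^2]. *)
      replace (q (S i) - q i) with (sin (dl i - dl (S i)) * (/ sin (dl i) * / sin (dl (S i)))).
      2:{ rewrite sin_minus; unfold q; field; lra. }
      rewrite Rabs_mult, (Rabs_right (/ sin (dl i) * _)).
      2:{ apply Rle_ge; left; apply Rmult_lt_0_compat; apply Rinv_0_lt_compat; lra. }
      replace (8 * mu / (lam * lam)) with (mu / 2 * (/ (lam / 4) * / (lam / 4))) by (field; lra).
      apply Rmult_le_compat; [apply Rabs_pos| | |].
      + left; apply Rmult_lt_0_compat; apply Rinv_0_lt_compat; lra.
      + eapply Rle_trans; [apply sin_abs_le|].
        specialize (Hm i Hi). rewrite Rabs_minus_sym.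
        replace (dl (S i) - dl i) with ((G (S (S i)) - G (S i) - (G (S i) - G i)) * / 2) by (unfold dl; field).
        rewrite Rabs_mult, (Rabs_right (/2)); lra.
      + apply Rmult_le_compat; try (left; apply Rinv_0_lt_compat; lra);
        apply Rinv_le_contravar; lra. }
  apply Rabs_le_elim in H3.
  destruct (COS_bound (G m + c)), (COS_bound (G 0%nat + c)).
  replace (4 / lam) with (/2 * (2 * (4 / lam))) by (field; lra).
  replace (INR m * (4 * mu / (lam * lam))) with (/2 * (INR m * (8 * mu / (lam * lam)))) by (field; lra).
  lra.
Qed.

(** * Weyl-van der Corput differencing *)

(* [|sum_(i < m) e^(iF(a+i))| <= tau P] for all short sums: the free phase [c] replaces the modulus. *)
Definition cos_sums_le (P : nat) (s tau : R) (F : R -> R) : Prop :=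
  forall a m c, INR P <= a <= s * INR P -> (m <= P)%nat ->
    rsum m (fun i => cos (F (a + INR i) + c)) <= tau * INR P.

Definition fdiff (h : nat) (F : R -> R) (x : R) : R := F (x + INR h) - F x.

Lemma rsum_shift_le m h u :
  (forall i, Rabs (u i) <= 1) -> rsum m u <= rsum m (fun i => u (i + h)%nat) + 2 * INR h.
Proof.
  intros Hu.
  pose proof (rsum_app m h u) as H1; pose proof (rsum_app h m u) as H2.
  rewrite Nat.add_comm, H2 in H1.
  assert (rsum h u <= INR h * 1) by
    (apply rsum_le_const; intros i _; specialize (Hu i); apply Rabs_le_elim in Hu; lra).
  assert (rsum h (fun i => -1 * u (m + i)%nat) <= INR h * 1).
  { apply rsum_le_const; intros i _; specialize (Hu (m + i)%nat); apply Rabs_le_elim in Hu; lra. }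
  rewrite rsum_scal in H0.
  rewrite (rsum_ext m (fun i => u (i + h)%nat) (fun i => u (h + i)%nat)) by (intros; f_equal; lia).
  lra.
Qed.

Lemma rsum_interval_indicator n a b :
  rsum n (fun j => if (andb (a <=? j) (j <? b))%nat then 1 else 0) <= INR (b - a).
Proof.
  (* Only the count of the part of the interval lying below [n] is stable under induction. *)
  apply Rle_trans with (INR (Nat.min n b - Nat.min n a)); [|apply le_INR; lia].
  induction n as [|n IH]; [simpl; lra|].
  simpl rsum.
  destruct (Nat.leb_spec a n), (Nat.ltb_spec n b); simpl andb; cbv iota.
  - replace (Nat.min (S n) b - Nat.min (S n) a)%nat with (S (Nat.min n b - Nat.min n a))%nat by lia.
    rewrite S_INR; lra.
  - replace (Nat.min (S n) b - Nat.min (S n) a)%nat with (Nat.min n b - Nat.min n a)%nat by lia; lra.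
  - replace (Nat.min (S n) b - Nat.min (S n) a)%nat with (Nat.min n b - Nat.min n a)%nat by lia; lra.
  - replace (Nat.min (S n) b - Nat.min (S n) a)%nat with (Nat.min n b - Nat.min n a)%nat by lia; lra.
Qed.

(** Averaging over [H] shifts costs [2 * INR H], the [2 * w] outside the root. Cauchy-Schwarz then
    produces correlations of pairs of shifts: pairs closer than [H0] are bounded trivially and give
    the inner [2 * w], all others are sums of [fdiff (h - h') F] and give [tau]. The cutoff [H0]
    keeps out short shifts, whose differenced phase would vary too slowly. The base point moves by
    at most [H <= P], hence [s + 1]. *)
Lemma van_der_corput P H0 H s F tau w :
  (1 <= H)%nat -> INR H <= w * INR P -> INR H0 <= w * INR H -> w <= 1 -> 0 <= tau ->
  (forall h, (H0 <= h <= H)%nat -> cos_sums_le P (s + 1) tau (fdiff h F)) ->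
  cos_sums_le P s (2 * w + sqrt (2 * w + tau)) F.
Proof.
  intros HH HHP HH0 Hw Htau HF a m c Ha Hm.
  assert (HP0 := pos_INR P); assert (Hm0 := pos_INR m).
  assert (Hm' : INR m <= INR P) by (apply le_INR; assumption).
  assert (HHpos : 1 <= INR H) by (change 1 with (INR 1); apply le_INR; assumption).
  assert (Hwpos : 0 <= w) by (assert (0 <= INR H0) by apply pos_INR; nra).
  assert (HHP' : INR H <= INR P) by nra.
  set (S := rsum m (fun i => cos (F (a + INR i) + c))).
  set (x := fun i h => F (a + INR (i + h)) + c).
  set (X := rsum m (fun i => rsum H (fun h => cos (x i h)))).
  assert (HS : INR H * S <= X + INR H * (2 * INR H)).
  { rewrite <- rsum_const. unfold X; rewrite rsum_exchange.
    rewrite <- rsum_const, <- rsum_plus.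
    apply rsum_le; intros h Hh; unfold S.
    eapply Rle_trans; [apply (rsum_shift_le m h)|].
    - intros; apply Rabs_cos_le.
    - unfold x. assert (INR h <= INR H) by (apply le_INR; lia). simpl; lra. }
  assert (Hpair : forall h h', (h < H)%nat -> (h' <= h)%nat ->
    rsum m (fun i => cos (x i h - x i h')) <= tau * INR P
      + INR P * (if (h <? h' + H0)%nat then 1 else 0)).
  { intros h h' Hh Hh'.
    destruct (Nat.ltb_spec h (h' + H0)).
    - apply Rle_trans with (INR m * 1); [apply rsum_le_const; intros; apply COS_bound|].
      assert (0 <= tau * INR P) by (apply Rmult_le_pos; lra). lra.
    - specialize (HF (h - h')%nat ltac:(lia) (a + INR h') m 0).
      rewrite Rmult_0_r, Rplus_0_r. eapply Rle_trans; [|apply HF].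
      + right; apply rsum_ext; intros i _; unfold fdiff, x. rewrite Rplus_0_r.
        f_equal. rewrite minus_INR by lia. rewrite !plus_INR.
        replace (a + INR h' + INR i + (INR h - INR h')) with (a + (INR i + INR h)) by ring.
        replace (a + INR h' + INR i) with (a + (INR i + INR h')) by ring. ring.
      + assert (INR h' <= INR H) by (apply le_INR; lia). assert (0 <= INR h') by apply pos_INR.
        lra.
      + assumption. }
  (* The cosine is even, so the order of [h] and [h'] is immaterial. The close [h'] form an interval
     of length at most [2 * H0]; its left end [h + 1 - H0] is truncated at 0. *)
  assert (Hpair' : forall h h', (h < H)%nat -> (h' < H)%nat ->
    rsum m (fun i => cos (x i h - x i h')) <= tau * INR P
      + INR P * (if (andb (h + 1 - H0 <=? h') (h' <? h + H0))%nat then 1 else 0)).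
  { intros h h' Hh Hh'.
    destruct (Nat.le_ge_cases h' h) as [Hle|Hle].
    - eapply Rle_trans; [apply Hpair; assumption|].
      apply Rplus_le_compat_l, Rmult_le_compat_l; [assumption|].
      destruct (Nat.ltb_spec h (h' + H0)), (Nat.leb_spec (h + 1 - H0) h'), (Nat.ltb_spec h' (h + H0)); simpl; try lra; lia.
    - rewrite (rsum_ext m _ (fun i => cos (x i h' - x i h))).
      2:{ intros i _; rewrite <- cos_neg; f_equal; ring. }
      eapply Rle_trans; [apply Hpair; assumption|].
      apply Rplus_le_compat_l, Rmult_le_compat_l; [assumption|].
      destruct (Nat.ltb_spec h' (h + H0)), (Nat.leb_spec (h + 1 - H0) h'); simpl; try lra; lia. }
  assert (HX : X² <= (INR P * INR H)² * (2 * w + tau)).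
  { apply Rle_trans with (INR m * rsum m (fun i => (rsum H (fun h => cos (x i h)))²)).
    { apply rsum_cauchy_schwarz. }
    apply Rle_trans with (INR m * rsum m (fun i => rsum H (fun h => rsum H (fun h' => cos (x i h - x i h'))))).
    { apply Rmult_le_compat_l; [assumption|]. apply rsum_le; intros i _.
      (* Adding the square of the sine sum completes the squared modulus, which expands into the
         correlations. *)
      rewrite <- rsum_cos_sin_sqr. assert (0 <= (rsum H (fun i0 => sin (x i i0)))²) by apply Rle_0_sqr. lra. }
    assert (HY : rsum m (fun i => rsum H (fun h => rsum H (fun h' => cos (x i h - x i h'))))
       <= INR H * (INR H * (tau * INR P) + INR P * (2 * INR H0))).
    { rewrite rsum_exchange. apply rsum_le_const; intros h Hh. rewrite rsum_exchange.
      eapply Rle_trans; [apply rsum_le; intros h' Hh'; apply Hpair'; assumption|].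
      rewrite rsum_plus, rsum_const, rsum_scal. apply Rplus_le_compat_l, Rmult_le_compat_l; [assumption|].
      eapply Rle_trans; [apply rsum_interval_indicator|].
      replace (2 * INR H0) with (INR (2 * H0)) by (rewrite mult_INR; reflexivity).
      apply le_INR; lia. }
    apply Rle_trans with (INR P * (INR H * (INR H * (tau * INR P) + INR P * (2 * (w * INR H))))).
    2:{ unfold Rsqr; right; ring. }
    apply Rle_trans with (INR m * (INR H * (INR H * (tau * INR P) + INR P * (2 * INR H0)))).
    { apply Rmult_le_compat_l; assumption. }
    assert (0 <= INR H0) by apply pos_INR.
    assert (0 <= tau * INR P) by (apply Rmult_le_pos; lra).
    apply Rmult_le_compat; [assumption| |assumption|].
    - apply Rmult_le_pos; [lra|]. apply Rplus_le_le_0_compat; apply Rmult_le_pos; lra.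
    - apply Rmult_le_compat_l; [lra|]. apply Rplus_le_compat_l, Rmult_le_compat_l; lra. }
  assert (HX' : X <= INR P * INR H * sqrt (2 * w + tau)).
  { apply Rsqr_incr_0_var.
    - rewrite Rsqr_mult, Rsqr_sqrt by lra. exact HX.
    - apply Rmult_le_pos; [apply Rmult_le_pos; lra|apply sqrt_pos]. }
  fold S. apply Rmult_le_reg_l with (INR H); [lra|].
  eapply Rle_trans; [exact HS|].
  replace (INR H * ((2 * w + sqrt (2 * w + tau)) * INR P)) with
    (INR P * INR H * sqrt (2 * w + tau) + INR H * (2 * (w * INR P))) by ring.
  apply Rplus_le_compat; [exact HX'|]. apply Rmult_le_compat_l; lra.
Qed.

Definition iter_diff (hs : list nat) (F : R -> R) : R -> R := fold_left (fun G h => fdiff h G) hs F.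

Definition iter_sqrt (k : nat) (x : R) : R := Nat.iter k sqrt x.

Lemma iter_sqrt_bounds k x : 0 <= x <= 1 -> x <= iter_sqrt k x <= 1.
Proof.
  intros Hx; induction k as [|k IH]; simpl; [lra|].
  unfold iter_sqrt in *; simpl. set (y := Nat.iter k sqrt x) in *.
  assert (0 <= sqrt y) by apply sqrt_pos.
  assert (sqrt y * sqrt y = y) by (apply sqrt_sqrt; lra).
  split; [|rewrite <- sqrt_1; apply sqrt_le_1_alt; lra].
  assert (sqrt y <= 1) by (rewrite <- sqrt_1; apply sqrt_le_1_alt; lra). nra.
Qed.

(** Every differencing takes one square root of the saving. The factor 10 reproduces itself: if [y]
    is the bound before the last root, then [w <= y] and [w <= sqrt y] give [2w + sqrt(2w + 10y) <=
    2 sqrt y + sqrt(16y) = 6 sqrt y]. *)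
Lemma cos_sums_le_weyl P H0 H w (D : nat) : forall s F,
  (1 <= H)%nat -> INR H <= w * INR P -> INR H0 <= w * INR H -> 0 <= w <= 1 ->
  (forall hs, length hs = D -> Forall (fun h => (H0 <= h <= H)%nat) hs ->
     cos_sums_le P (s + INR D) w (iter_diff hs F)) ->
  cos_sums_le P s (10 * iter_sqrt D w) F.
Proof.
  induction D as [|D IH]; intros s F HH HHP HH0 Hw HF.
  - intros a m c Ha Hm.
    specialize (HF [] eq_refl (Forall_nil _) a m c). simpl in HF.
    rewrite Rplus_0_r in HF. specialize (HF Ha Hm). unfold iter_sqrt; simpl.
    assert (0 <= INR P) by apply pos_INR. unfold iter_diff in HF; simpl in HF.
    eapply Rle_trans; [exact HF|]. nra.
  - assert (Hb := iter_sqrt_bounds D w Hw); assert (Hb' := iter_sqrt_bounds (S D) w Hw).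
    intros a m c Ha Hm.
    eapply Rle_trans; [apply (van_der_corput P H0 H s F (10 * iter_sqrt D w) w); try assumption; try lra|].
    + intros h Hh. apply IH; try assumption.
      intros hs Hl Hhs. replace (s + 1 + INR D) with (s + INR (S D)) by (rewrite S_INR; ring).
      apply (HF (h :: hs)); [simpl; lia|constructor; assumption].
    + apply Rmult_le_compat_r; [apply pos_INR|].
      unfold iter_sqrt in *; simpl in *. set (y := Nat.iter D sqrt w) in *.
      apply Rle_trans with (2 * sqrt y + sqrt (16 * y)).
      * apply Rplus_le_compat; [lra|apply sqrt_le_1_alt; lra].
      * rewrite sqrt_mult by lra. replace 16 with (4 * 4) by ring. rewrite sqrt_square by lra.
        assert (0 <= sqrt y) by apply sqrt_pos. lra.
Qed.

(** * Iterated differences controlled by derivatives *)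

(** Carrying all derivatives as one sequence lets differencing and scaling act on the whole tower.
    The restriction to [x > 0] is the range where real powers are differentiated. *)
Definition derivative_tower (g : nat -> R -> R) : Prop :=
  forall i x, 0 < x -> derivable_pt_lim (g i) x (g (S i) x).

Definition hprod (hs : list nat) : R := fold_right (fun h p => INR h * p) 1 hs.
Definition hsum (hs : list nat) : R := fold_right (fun h p => INR h + p) 0 hs.

Lemma hsum_nonneg hs : 0 <= hsum hs.
Proof. induction hs as [|h hs IH]; simpl; [lra|]. assert (0 <= INR h) by apply pos_INR. lra. Qed.

Lemma derivative_tower_fdiff h g :
  derivative_tower g -> derivative_tower (fun i => fdiff h (g i)).
Proof.
  intros Hg i x Hx; unfold fdiff.
  apply (derivable_pt_lim_minus (fun x => g i (x + INR h)) (g i)); [|apply Hg; assumption].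
  assert (0 <= INR h) by apply pos_INR.
  assert (H1 : derivable_pt_lim (fun y => y + INR h) x 1).
  { rewrite <- (Rplus_0_r 1). apply (derivable_pt_lim_plus id (fct_cte (INR h))).
    - apply derivable_pt_lim_id.
    - apply derivable_pt_lim_const. }
  assert (H2 := derivable_pt_lim_comp (fun y => y + INR h) (g i) x 1 (g (S i) (x + INR h)) H1).
  rewrite Rmult_1_r in H2. apply H2, Hg; lra.
Qed.

(** One mean value theorem per shift. The induction ranges over all towers, so the first shift is
    absorbed by passing to the tower of [fdiff h (g i)]; a shift [h = 0] makes both sides vanish. *)
Lemma iter_diff_bounds : forall hs g a A B, derivative_tower g -> 0 < a ->
  (forall x, a <= x <= a + hsum hs -> A <= g (length hs) x <= B) ->
  hprod hs * A <= iter_diff hs (g 0%nat) a <= hprod hs * B.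
Proof.
  induction hs as [|h hs IH]; intros g a A B Hg Ha HAB.
  - unfold iter_diff; simpl in *. specialize (HAB a ltac:(lra)). lra.
  - assert (Hh := pos_INR h).
    replace (hprod (h :: hs) * A) with (hprod hs * (INR h * A)) by (simpl; ring).
    replace (hprod (h :: hs) * B) with (hprod hs * (INR h * B)) by (simpl; ring).
    apply (IH (fun i => fdiff h (g i))); [apply derivative_tower_fdiff; assumption|assumption|].
    intros x Hx; unfold fdiff. simpl in HAB.
    destruct Hh as [Hh|Hh].
    + destruct (MVT_cor2 (g (length hs)) (g (S (length hs))) x (x + INR h)) as [y [Hy1 Hy2]]; [lra| |].
      * intros y Hy; apply Hg; lra.
      * rewrite Hy1. specialize (HAB y ltac:(lra)).
        replace (x + INR h - x) with (INR h) by ring. nra.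
    + rewrite <- Hh, Rplus_0_r. lra.
Qed.

(** * Detecting points in a box of the torus *)

Definition rsum4 (K : nat) (f : nat -> nat -> nat -> nat -> R) : R :=
  rsum K (fun j => rsum K (fun j' => rsum K (fun l => rsum K (fun l' => f j j' l l')))).

Lemma rsum4_le K f g :
  (forall j j' l l', (j < K)%nat -> (j' < K)%nat -> (l < K)%nat -> (l' < K)%nat ->
     f j j' l l' <= g j j' l l') -> rsum4 K f <= rsum4 K g.
Proof. intros H; unfold rsum4; do 4 (apply rsum_le; intros); apply H; assumption. Qed.

Lemma rsum4_ext K f g : (forall j j' l l', f j j' l l' = g j j' l l') -> rsum4 K f = rsum4 K g.
Proof. intros H; unfold rsum4; do 4 (apply rsum_ext; intros); apply H. Qed.

Lemma rsum4_plus K f g :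
  rsum4 K (fun j j' l l' => f j j' l l' + g j j' l l') = rsum4 K f + rsum4 K g.
Proof.
  unfold rsum4. do 3 (rewrite <- rsum_plus; apply rsum_ext; intros).
  apply rsum_plus.
Qed.

Lemma rsum4_scal K c f : rsum4 K (fun j j' l l' => c * f j j' l l') = c * rsum4 K f.
Proof.
  unfold rsum4. do 3 (rewrite <- rsum_scal; apply rsum_ext; intros).
  apply rsum_scal.
Qed.

Lemma rsum4_const K c : rsum4 K (fun _ _ _ _ => c) = INR K ^ 4 * c.
Proof.
  unfold rsum4. rewrite (rsum_const K (rsum K (fun _ => rsum K (fun _ => rsum K (fun _ => c))))).
  rewrite !rsum_const; ring.
Qed.

Lemma rsum4_exchange K L (f : nat -> nat -> nat -> nat -> nat -> R) :
  rsum L (fun i => rsum4 K (f i)) = rsum4 K (fun j j' l l' => rsum L (fun i => f i j j' l l')).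
Proof.
  unfold rsum4. do 3 (rewrite rsum_exchange; apply rsum_ext; intros).
  apply rsum_exchange.
Qed.

Lemma rsum4_mul K a b :
  rsum4 K (fun j j' l l' => a j j' * b l l') =
  rsum K (fun j => rsum K (a j)) * rsum K (fun l => rsum K (b l)).
Proof.
  unfold rsum4.
  rewrite Rmult_comm, <- rsum_scal; apply rsum_ext; intros j _.
  rewrite <- rsum_scal; apply rsum_ext; intros j' _.
  rewrite Rmult_comm, <- rsum_scal; apply rsum_ext; intros l _.
  apply rsum_scal.
Qed.

Lemma rsum_double_cos_sin_sqr K (A : nat -> nat -> R) :
  (rsum K (fun j => rsum K (fun l => cos (A j l))))² +
  (rsum K (fun j => rsum K (fun l => sin (A j l))))²
  = rsum4 K (fun j j' l l' => cos (A j l - A j' l')).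
Proof.
  unfold rsum4, Rsqr; rewrite !rsum_mul, <- rsum_plus; apply rsum_ext; intros j _.
  rewrite <- rsum_plus; apply rsum_ext; intros j' _.
  rewrite !rsum_mul, <- rsum_plus; apply rsum_ext; intros l _.
  rewrite <- rsum_plus; apply rsum_ext; intros l' _.
  rewrite cos_minus; reflexivity.
Qed.

Definition zero_indic (z : Z) : R := if Z.eqb z 0 then 1 else 0.

Lemma rsum_zero_indic K z :
  rsum K (fun j => zero_indic (z - Z.of_nat j)) =
  if andb (0 <=? z)%Z (z <? Z.of_nat K)%Z then 1 else 0.
Proof.
  induction K as [|K IH].
  - simpl; destruct (Z.leb_spec 0 z), (Z.ltb_spec z 0); simpl; try lra; lia.
  - cbn [rsum]; rewrite IH; unfold zero_indic.
    destruct (Z.eqb_spec (z - Z.of_nat K) 0), (Z.leb_spec 0 z), (Z.ltb_spec z (Z.of_nat K)),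
      (Z.ltb_spec z (Z.of_nat (S K))); simpl; try lra; lia.
Qed.

(** The Fourier coefficient at [e] of the unnormalised Fejer kernel, that is [K - |e|] for
    [|e| <= K]. Only [e = 0, 1, -1] occur below, since a factor [cos] shifts frequencies by one. *)
Definition diag_count (K : nat) (e : Z) : R :=
  rsum K (fun j => rsum K (fun j' => zero_indic (Z.of_nat j - Z.of_nat j' + e))).

Lemma diag_count_eq K e : diag_count K e =
  rsum K (fun j => if andb (0 <=? Z.of_nat j + e)%Z (Z.of_nat j + e <? Z.of_nat K)%Z then 1 else 0).
Proof.
  apply rsum_ext; intros j _. rewrite <- rsum_zero_indic.
  apply rsum_ext; intros j' _. f_equal; lia.
Qed.

Lemma diag_count_0 K : diag_count K 0 = INR K.
Proof.
  rewrite diag_count_eq, <- (Rmult_1_r (INR K)), <- rsum_const.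
  apply rsum_ext; intros j Hj.
  destruct (Z.leb_spec 0 (Z.of_nat j + 0)), (Z.ltb_spec (Z.of_nat j + 0) (Z.of_nat K)); simpl; try lra; lia.
Qed.

Lemma diag_count_succ K : (1 <= K)%nat -> INR K - 1 <= diag_count K 1.
Proof.
  intros HK; rewrite diag_count_eq. destruct K as [|K]; [lia|].
  rewrite S_INR; cbn [rsum].
  assert (H : INR K * 1 <= rsum K (fun j => if andb (0 <=? Z.of_nat j + 1)%Z (Z.of_nat j + 1 <? Z.of_nat (S K))%Z then 1 else 0)).
  { rewrite <- rsum_const; apply rsum_le; intros j Hj.
    destruct (Z.leb_spec 0 (Z.of_nat j + 1)), (Z.ltb_spec (Z.of_nat j + 1) (Z.of_nat (S K))); simpl; try lra; lia. }
  match goal with |- _ <= _ + (if ?b then _ else _) => destruct b end; lra.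
Qed.

Lemma diag_count_pred K : (1 <= K)%nat -> INR K - 1 <= diag_count K (-1).
Proof.
  intros HK; rewrite diag_count_eq. destruct K as [|K]; [lia|].
  change (S K) with (1 + K)%nat at 2. rewrite S_INR, rsum_app.
  assert (H : INR K * 1 <= rsum K (fun i => if andb (0 <=? Z.of_nat (1 + i) + -1)%Z (Z.of_nat (1 + i) + -1 <? Z.of_nat (S K))%Z then 1 else 0)).
  { rewrite <- rsum_const; apply rsum_le; intros j Hj.
    destruct (Z.leb_spec 0 (Z.of_nat (1 + j) + -1)), (Z.ltb_spec (Z.of_nat (1 + j) + -1) (Z.of_nat (S K))); simpl; try lra; lia. }
  cbn [rsum]. match goal with |- _ <= _ + (if ?b then _ else _) + _ => destruct b end; lra.
Qed.

(* Outside the box the factor [cos 2pi x + cos 2pi y - 1 - cos 2pi eps] is nonpositive; multiplied by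
   the two-dimensional Fejer kernel it nevertheless has positive mean once [K > 2 / (1 - cos 2pi eps)]. *)
Lemma exists_in_box (L K : nat) (x y : nat -> R) (sigma eps : R) :
  (1 <= K)%nat -> 0 <= sigma ->
  (forall u v : Z, (Z.abs u <= Z.of_nat K)%Z -> (Z.abs v <= Z.of_nat K)%Z -> (u <> 0 \/ v <> 0)%Z ->
     Rabs (rsum L (fun i => cos (2 * PI * (IZR u * x i + IZR v * y i)))) <= sigma) ->
  4 * INR K ^ 2 * sigma < INR L * (1 - cos (2 * PI * eps) - 2 / INR K) ->
  exists i, (i < L)%nat /\ cos (2 * PI * eps) < cos (2 * PI * x i) /\
    cos (2 * PI * eps) < cos (2 * PI * y i).
Proof.
  intros HK Hsig HS Hlt.
  apply NNPP; intros Hno.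
  assert (HKpos : 1 <= INR K) by (change 1 with (INR 1); apply le_INR; assumption).
  set (k := cos (2 * PI * eps)) in *.
  assert (Hk : -1 <= k <= 1) by apply COS_bound.
  set (S := fun u v : Z => rsum L (fun i => cos (2 * PI * (IZR u * x i + IZR v * y i)))).
  (* The Fejer kernel at the point [(x i, y i)], written out as a sum over pairs of frequencies; as
     a squared modulus it is nonnegative. *)
  set (W := fun i => rsum4 K (fun j j' l l' =>
     cos (2 * PI * (INR j * x i + INR l * y i) - 2 * PI * (INR j' * x i + INR l' * y i)))).
  assert (HT : rsum L (fun i => (cos (2 * PI * x i) + cos (2 * PI * y i) - 1 - k) * W i) <= 0).
  { rewrite <- (Rmult_0_r (INR L)). apply rsum_le_const; intros i Hi.
    assert (0 <= W i).
    { unfold W; rewrite <- (rsum_double_cos_sin_sqr K (fun j l => 2 * PI * (INR j * x i + INR l * y i))).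
      apply Rplus_le_le_0_compat; apply Rle_0_sqr. }
    assert (cos (2 * PI * x i) + cos (2 * PI * y i) - 1 - k <= 0).
    { destruct (COS_bound (2 * PI * x i)), (COS_bound (2 * PI * y i)).
      destruct (Rle_dec (cos (2 * PI * x i)) k); [lra|].
      destruct (Rle_dec (cos (2 * PI * y i)) k); [lra|].
      exfalso; apply Hno; exists i; repeat split; [assumption|lra|lra]. }
    nra. }
  set (dl := fun u v => zero_indic u * zero_indic v).
  assert (HS' : forall u v, (Z.abs u <= Z.of_nat K)%Z -> (Z.abs v <= Z.of_nat K)%Z ->
     INR L * dl u v - sigma <= S u v <= INR L * dl u v + sigma).
  { intros u v Hu Hv; unfold dl, zero_indic.
    destruct (Z.eqb_spec u 0) as [->|Hu0]; [destruct (Z.eqb_spec v 0) as [->|Hv0]|].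
    - replace (S 0%Z 0%Z) with (INR L * 1); [lra|].
      unfold S; rewrite <- rsum_const; apply rsum_ext; intros i _.
      rewrite !Rmult_0_l, Rplus_0_r, Rmult_0_r, cos_0; reflexivity.
    - specialize (HS 0%Z v Hu Hv (or_intror Hv0)). apply Rabs_le_elim in HS. fold (S 0%Z v) in HS. lra.
    - specialize (HS u v Hu Hv (or_introl Hu0)). apply Rabs_le_elim in HS. fold (S u v) in HS.
      rewrite Rmult_0_l; lra. }
  set (E := fun j j' l l' : nat => let u := (Z.of_nat j - Z.of_nat j')%Z in let v := (Z.of_nat l - Z.of_nat l')%Z in
     / 2 * (S (u + 1)%Z v + S (u + -1)%Z v + S u (v + 1)%Z + S u (v + -1)%Z) - (1 + k) * S u v).
  assert (HE : rsum L (fun i => (cos (2 * PI * x i) + cos (2 * PI * y i) - 1 - k) * W i) = rsum4 K E).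
  { transitivity (rsum L (fun i => rsum4 K (fun j j' l l' => (cos (2 * PI * x i) + cos (2 * PI * y i) - 1 - k) *
       cos (2 * PI * (INR j * x i + INR l * y i) - 2 * PI * (INR j' * x i + INR l' * y i))))).
    { apply rsum_ext; intros i _; unfold W. rewrite rsum4_scal; reflexivity. }
    rewrite rsum4_exchange. apply rsum4_ext; intros j j' l l'. unfold E, S; cbv zeta.
    rewrite <- !rsum_plus, <- rsum_scal.
    match goal with |- _ = ?a - ?b * ?c => replace (a - b * c) with (a + - b * c) by ring end.
    rewrite <- rsum_scal, <- rsum_plus.
    apply rsum_ext; intros i _.
    set (t := 2 * PI * (INR j * x i + INR l * y i) - (2 * PI * (INR j' * x i + INR l' * y i))).
    rewrite !plus_IZR, !minus_IZR, <- !INR_IZR_INZ.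
    replace (2 * PI * ((INR j - INR j' + 1) * x i + (INR l - INR l') * y i)) with (t + 2 * PI * x i) by (unfold t; ring).
    replace (2 * PI * ((INR j - INR j' + -1) * x i + (INR l - INR l') * y i)) with (t - 2 * PI * x i) by (unfold t; ring).
    replace (2 * PI * ((INR j - INR j') * x i + (INR l - INR l' + 1) * y i)) with (t + 2 * PI * y i) by (unfold t; ring).
    replace (2 * PI * ((INR j - INR j') * x i + (INR l - INR l' + -1) * y i)) with (t - 2 * PI * y i) by (unfold t; ring).
    replace (2 * PI * ((INR j - INR j') * x i + (INR l - INR l') * y i)) with t by (unfold t; ring).
    rewrite !cos_plus, !cos_minus. field. }
  rewrite HE in HT.
  (* The contribution of frequency zero alone. The terms [+ 0] give every summand the shape that
     factors into two values of [diag_count]. *)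
  set (M := fun j j' l l' : nat => let u := (Z.of_nat j - Z.of_nat j')%Z in let v := (Z.of_nat l - Z.of_nat l')%Z in
     / 2 * (dl (u + 1)%Z (v + 0)%Z + dl (u + -1)%Z (v + 0)%Z + dl (u + 0)%Z (v + 1)%Z + dl (u + 0)%Z (v + -1)%Z)
     + - (1 + k) * dl (u + 0)%Z (v + 0)%Z).
  (* The four shifted sums with weight 1/2 lose [2 * sigma], and the central one with weight
     [1 + k <= 2] loses another [2 * sigma]. *)
  assert (HM : rsum4 K (fun j j' l l' => INR L * M j j' l l' + - (4 * sigma)) <= rsum4 K E).
  { apply rsum4_le; intros j j' l l' Hj Hj' Hl Hl'. unfold M, E; cbv zeta.
    set (u := (Z.of_nat j - Z.of_nat j')%Z); set (v := (Z.of_nat l - Z.of_nat l')%Z).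
    rewrite !Z.add_0_r.
    assert (H1 := HS' (u + 1)%Z v ltac:(lia) ltac:(lia)).
    assert (H2 := HS' (u + -1)%Z v ltac:(lia) ltac:(lia)).
    assert (H3 := HS' u (v + 1)%Z ltac:(lia) ltac:(lia)).
    assert (H4 := HS' u (v + -1)%Z ltac:(lia) ltac:(lia)).
    assert (H5 := HS' u v ltac:(lia) ltac:(lia)).
    assert ((1 + k) * S u v <= (1 + k) * (INR L * dl u v + sigma)) by (apply Rmult_le_compat_l; lra).
    assert ((1 + k) * sigma <= 2 * sigma) by (apply Rmult_le_compat_r; lra).
    lra. }
  rewrite rsum4_plus, rsum4_scal, rsum4_const in HM.
  assert (HMeq : rsum4 K M = / 2 * (diag_count K 1 * diag_count K 0 + diag_count K (-1) * diag_count K 0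
     + diag_count K 0 * diag_count K 1 + diag_count K 0 * diag_count K (-1)) + - (1 + k) * (diag_count K 0 * diag_count K 0)).
  { unfold M, dl; cbv zeta. rewrite rsum4_plus, !rsum4_scal, !rsum4_plus.
    assert (Hp : forall e e', rsum4 K (fun j j' l l' => zero_indic (Z.of_nat j - Z.of_nat j' + e) * zero_indic (Z.of_nat l - Z.of_nat l' + e'))
       = diag_count K e * diag_count K e').
    { intros e e'; apply rsum4_mul. }
    rewrite !Hp; reflexivity. }
  assert (H0 := diag_count_0 K). assert (H1 := diag_count_succ K HK). assert (H2 := diag_count_pred K HK).
  rewrite HMeq, H0 in HM.
  set (kk := INR K) in *.
  assert (HL : 0 <= INR L) by apply pos_INR.
  (* The mean of the factor against the kernel is at least [2K(K - 1) - (1 + k)K^2]; the loss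
     [2 / K] comes from the coefficients [K - 1]. *)
  assert (HLk : INR L * (kk * kk * (1 - k - 2 / kk)) <= INR L * (/ 2 * (diag_count K 1 * kk + diag_count K (-1) * kk
     + kk * diag_count K 1 + kk * diag_count K (-1)) + - (1 + k) * (kk * kk))).
  { apply Rmult_le_compat_l; [assumption|].
    replace (kk * kk * (1 - k - 2 / kk)) with (2 * (kk * (kk - 1)) + - (1 + k) * (kk * kk)) by (field; lra).
    nra. }
  assert (0 < kk * kk) by nra.
  assert (kk * kk * (4 * kk ^ 2 * sigma) < kk * kk * (INR L * (1 - k - 2 / kk))) by (apply Rmult_lt_compat_l; assumption).
  nra.
Qed.

(** * Derivatives of pseudo-polynomials *)

Lemma Rpower_pos x y : 0 < Rpower x y.
Proof. apply exp_pos. Qed.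

Lemma Rpower_ge_const C e : 0 < e -> exists x0, 1 <= x0 /\ forall x, x0 <= x -> C <= Rpower x e.
Proof.
  intros He. set (M := Rmax C 1).
  assert (HM : 1 <= M) by apply Rmax_r.
  assert (HC : C <= M) by apply Rmax_l.
  exists (Rpower M (/ e)).
  assert (H1 : 1 <= Rpower M (/ e)).
  { rewrite <- (Rpower_O M) by lra. apply Rle_Rpower; [lra|]. left; apply Rinv_0_lt_compat; lra. }
  split; [assumption|]. intros x Hx.
  apply Rle_trans with M; [assumption|].
  replace M with (Rpower (Rpower M (/ e)) e) at 1.
  - apply Rle_Rpower_l; lra.
  - rewrite Rpower_mult, Rinv_l, Rpower_1; lra.
Qed.

Lemma pseudo_poly_ext d b b' t t' x :
  (forall i, (i < d)%nat -> b i = b' i /\ t i = t' i) -> pseudo_poly d b t x = pseudo_poly d b' t' x.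
Proof.
  induction d as [|d IH]; intros H; simpl; [reflexivity|].
  rewrite IH by (intros; apply H; lia). destruct (H d ltac:(lia)) as [-> ->]; reflexivity.
Qed.

(** The alternative [b i = 0] is there because terms killed by differentiation remain in the list
    with their exponents. *)
Lemma pseudo_poly_le_power d b t T : (forall i, (i < d)%nat -> b i = 0 \/ t i <= T) ->
  exists E, 0 < E /\ forall x, 1 <= x -> Rabs (pseudo_poly d b t x) <= E * Rpower x T.
Proof.
  induction d as [|d IH]; intros H.
  - exists 1; split; [lra|]. intros x _; simpl; rewrite Rabs_R0. generalize (Rpower_pos x T); lra.
  - destruct IH as [E [HE HEx]]; [intros; apply H; lia|].
    exists (E + Rabs (b d)); split; [generalize (Rabs_pos (b d)); lra|].
    intros x Hx; simpl. eapply Rle_trans; [apply Rabs_triang|].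
    rewrite Rmult_plus_distr_r. apply Rplus_le_compat; [apply HEx; assumption|].
    rewrite Rabs_mult, (Rabs_right (Rpower _ _)) by (left; apply Rpower_pos).
    destruct (H d ltac:(lia)) as [->|Ht]; [rewrite Rabs_R0; lra|].
    apply Rmult_le_compat_l; [apply Rabs_pos|]. apply Rle_Rpower; assumption.
Qed.

Lemma pseudo_poly_little_o d b t T : (forall i, (i < d)%nat -> b i = 0 \/ t i < T) ->
  forall eps, 0 < eps -> exists x0, 1 <= x0 /\ forall x, x0 <= x ->
    Rabs (pseudo_poly d b t x) <= eps * Rpower x T.
Proof.
  induction d as [|d IH]; intros H eps Heps.
  - exists 1; split; [lra|]. intros x _; simpl; rewrite Rabs_R0. generalize (Rpower_pos x T); nra.
  - destruct (IH ltac:(intros; apply H; lia) (eps / 2) ltac:(lra)) as [x1 [Hx1 HEx]].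
    destruct (H d ltac:(lia)) as [Hb|Ht].
    + exists x1; split; [assumption|]. intros x Hx; simpl. rewrite Hb, Rmult_0_l, Rplus_0_r.
      specialize (HEx x Hx). generalize (Rpower_pos x T); nra.
    + destruct (Rpower_ge_const (Rabs (b d) * (2 / eps)) (T - t d)) as [x2 [Hx2 H2]]; [lra|].
      exists (Rmax x1 x2). split; [apply Rle_trans with x1; [assumption|apply Rmax_l]|].
      intros x Hx. assert (x1 <= x) by (eapply Rle_trans; [apply Rmax_l|exact Hx]).
      assert (x2 <= x) by (eapply Rle_trans; [apply Rmax_r|exact Hx]).
      simpl. eapply Rle_trans; [apply Rabs_triang|].
      specialize (HEx x ltac:(assumption)). specialize (H2 x ltac:(assumption)).
      assert (Rabs (b d * Rpower x (t d)) <= eps / 2 * Rpower x T); [|lra].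
      rewrite Rabs_mult, (Rabs_right (Rpower _ _)) by (left; apply Rpower_pos).
      replace T with ((T - t d) + t d) by ring. rewrite Rpower_plus, <- Rmult_assoc.
      apply Rmult_le_compat_r; [left; apply Rpower_pos|].
      replace (Rabs (b d)) with (eps / 2 * (Rabs (b d) * (2 / eps))) by (field; lra).
      apply Rmult_le_compat_l; lra.
Qed.

Lemma pseudo_poly_split d b t j x : (j < d)%nat ->
  pseudo_poly d b t x = pseudo_poly d (fun i => if Nat.eqb i j then 0 else b i) t x + b j * Rpower x (t j).
Proof.
  induction d as [|d IH]; intros Hj; [lia|]. simpl.
  destruct (Nat.eqb_spec d j) as [->|Hd].
  - rewrite (pseudo_poly_ext j b (fun i => if Nat.eqb i j then 0 else b i) t t); [ring|].
    intros i Hi; destruct (Nat.eqb_spec i j); [lia|split; reflexivity].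
  - rewrite IH by lia. ring.
Qed.

Lemma pseudo_poly_dominant d b t j : (j < d)%nat ->
  (forall i, (i < d)%nat -> i <> j -> b i = 0 \/ t i < t j) ->
  forall eps, 0 < eps -> exists x0, 1 <= x0 /\ forall x, x0 <= x ->
    Rabs (pseudo_poly d b t x - b j * Rpower x (t j)) <= eps * Rpower x (t j).
Proof.
  intros Hj H eps Heps.
  destruct (pseudo_poly_little_o d (fun i => if Nat.eqb i j then 0 else b i) t (t j)) with (eps := eps)
    as [x0 [Hx0 Hx]]; [|assumption|].
  - intros i Hi; destruct (Nat.eqb_spec i j); [left; reflexivity|apply H; assumption].
  - exists x0; split; [assumption|]. intros x Hxx.
    rewrite (pseudo_poly_split d b t j x Hj).
    replace (_ + b j * Rpower x (t j) - b j * Rpower x (t j)) with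
      (pseudo_poly d (fun i => if Nat.eqb i j then 0 else b i) t x) by ring.
    apply Hx; assumption.
Qed.

Fixpoint falling (t : R) (k : nat) : R :=
  match k with O => 1 | S k => falling t k * (t - INR k) end.

Lemma falling_nat n k : (n < k)%nat -> falling (INR n) k = 0.
Proof.
  induction k as [|k IH]; intros H; [lia|]. simpl.
  destruct (Nat.eq_dec n k) as [->|Hn]; [ring|]. rewrite IH by lia; ring.
Qed.

Lemma falling_nonint t k : ~ (exists z : Z, t = IZR z) -> falling t k <> 0.
Proof.
  intros Ht; induction k as [|k IH]; simpl; [lra|].
  apply Rmult_integral_contrapositive; split; [assumption|].
  intros E; apply Ht; exists (Z.of_nat k). rewrite <- INR_IZR_INZ; lra.
Qed.

(** The derivative of order [k] is kept in the form [pseudo_poly], now with arbitrary signs and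
    exponents, so that the growth lemmas apply to it. *)
Definition pp_deriv (d : nat) (alpha theta : nat -> R) (k : nat) : R -> R :=
  pseudo_poly d (fun i => alpha i * falling (theta i) k) (fun i => theta i - INR k).

Lemma pp_deriv_0 d alpha theta x : pp_deriv d alpha theta 0 x = pseudo_poly d alpha theta x.
Proof. apply pseudo_poly_ext; intros; simpl; split; ring. Qed.

Lemma derivative_tower_pp d alpha theta : derivative_tower (pp_deriv d alpha theta).
Proof.
  intros k x Hx; unfold pp_deriv. induction d as [|d IH]; cbn [pseudo_poly].
  - apply derivable_pt_lim_const.
  - refine (derivable_pt_lim_plus _ (fun y => alpha d * falling (theta d) k * Rpower y (theta d - INR k))
      x _ _ IH _).
    match goal with |- derivable_pt_lim _ _ ?l => replace l with
      (alpha d * falling (theta d) k * ((theta d - INR k) * Rpower x (theta d - INR k - 1))) end.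
    + apply (derivable_pt_lim_scal (fun y => Rpower y (theta d - INR k))).
      apply derivable_pt_lim_power; assumption.
    + rewrite S_INR; cbn [falling]. replace (theta d - INR k - 1) with (theta d - (INR k + 1)) by ring. ring.
Qed.

Lemma derivative_tower_scal c g : derivative_tower g -> derivative_tower (fun k x => c * g k x).
Proof. intros H k x Hx. apply (derivable_pt_lim_scal (g k)). apply H; assumption. Qed.

Lemma exists_last (Q : nat -> Prop) d : (exists j, (j < d)%nat /\ Q j) ->
  exists j, (j < d)%nat /\ Q j /\ forall i, (j < i)%nat -> (i < d)%nat -> ~ Q i.
Proof.
  induction d as [|d IH]; intros [j [Hj Hq]]; [lia|].
  destruct (classic (Q d)) as [Hd|Hd].
  - exists d; repeat split; [lia|assumption|intros; lia].
  - destruct IH as [i [Hi [Hqi Hl]]].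
    + exists j; split; [|assumption]. destruct (Nat.eq_dec j d) as [->|]; [contradiction|lia].
    + exists i; repeat split; [lia|assumption|]. intros k Hk Hkd.
      destruct (Nat.eq_dec k d) as [->|]; [assumption|apply Hl; lia].
Qed.

Lemma exists_nat_ge x : exists n : nat, (1 <= n)%nat /\ x <= INR n.
Proof.
  exists (S (Z.to_nat (up x))). split; [lia|].
  destruct (archimed x) as [H _]. rewrite INR_IZR_INZ.
  apply Rle_trans with (IZR (up x)); [lra|]. apply IZR_le; lia.
Qed.

Lemma pseudo_poly_nonneg d alpha theta x :
  (forall i, (i < d)%nat -> 0 < alpha i) -> 0 <= pseudo_poly d alpha theta x.
Proof.
  induction d as [|d IH]; intros H; simpl; [lra|].
  specialize (IH ltac:(intros; apply H; lia)). specialize (H d ltac:(lia)).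
  generalize (Rpower_pos x (theta d)); nra.
Qed.

(* [T] is the largest non-integer exponent; differentiating [D + 1] times kills the integer ones. *)
Lemma pseudo_poly_structure d alpha theta : is_pseudo_poly d alpha theta ->
  exists (D : nat) (T c E x0 : R),
    (1 <= D)%nat /\ 1 < T < INR D /\ c <> 0 /\ 0 < E /\ 1 <= x0 /\
    (forall x, x0 <= x -> Rabs (pp_deriv d alpha theta (D + 1) x - c * Rpower x (T - INR (D + 1)))
        <= Rabs c / 2 * Rpower x (T - INR (D + 1))) /\
    (forall x, 1 <= x -> Rabs (pp_deriv d alpha theta (D + 2) x) <= E * Rpower x (T - INR (D + 2))) /\
    (forall x, 1 <= x -> 0 <= pseudo_poly d alpha theta x <= E * Rpower x (INR D)).
Proof.
  intros [Hd [Ha [_ [H1 [Hinc Hni]]]]].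
  apply exists_last in Hni. destruct Hni as [j [Hj [Hnij Hlast]]].
  destruct (exists_nat_ge (theta (d - 1)%nat)) as [D [HD HDt]].
  assert (HtD : forall i, (i < d)%nat -> theta i <= INR D).
  { intros i Hi. destruct (Nat.eq_dec i (d - 1)) as [->|]; [assumption|].
    specialize (Hinc i (d - 1)%nat ltac:(lia) ltac:(lia)). lra. }
  assert (Ht1 : forall i, (i < d)%nat -> 1 <= theta i).
  { intros i Hi. destruct (Nat.eq_dec i 0) as [->|]; [assumption|].
    specialize (Hinc 0%nat i ltac:(lia) ltac:(lia)). lra. }
  assert (HTl : 1 < theta j).
  { destruct (Ht1 j Hj) as [|E]; [assumption|]. exfalso; apply Hnij; exists 1%Z; lra. }
  assert (HTu : theta j < INR D).
  { destruct (HtD j Hj) as [|E]; [assumption|]. exfalso; apply Hnij; exists (Z.of_nat D). rewrite <- INR_IZR_INZ; lra. }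
  (* Below [j] the exponent is smaller. Above [j] it is an integer by maximality of [j], it lies in
     [[1, D]], and its falling factorial of order [k > D] contains a zero factor. *)
  assert (Hz : forall k i, (D < k)%nat -> (i < d)%nat -> i <> j ->
     alpha i * falling (theta i) k = 0 \/ theta i < theta j).
  { intros k i Hk Hi Hij. destruct (Nat.lt_ge_cases i j) as [Hl|Hl]; [right; apply Hinc; assumption|].
    left. apply Rmult_eq_0_compat_l.
    destruct (NNPP _ (Hlast i ltac:(lia) Hi)) as [z Hzz].
    assert (1 <= z)%Z by (apply le_IZR; rewrite <- Hzz; apply Ht1; assumption).
    assert (z <= Z.of_nat D)%Z by (apply le_IZR; rewrite <- Hzz, <- INR_IZR_INZ; apply HtD; assumption).
    rewrite Hzz. replace (IZR z) with (INR (Z.to_nat z)).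
    - apply falling_nat; lia.
    - rewrite INR_IZR_INZ, Z2Nat.id by lia. reflexivity. }
  assert (Hc : alpha j * falling (theta j) (D + 1) <> 0).
  { apply Rmult_integral_contrapositive; split; [specialize (Ha j Hj); lra|apply falling_nonint; assumption]. }
  set (c := alpha j * falling (theta j) (D + 1)) in *.
  destruct (pseudo_poly_dominant d (fun i => alpha i * falling (theta i) (D + 1)) (fun i => theta i - INR (D + 1)) j Hj) with (eps := Rabs c / 2)
    as [x0 [Hx0 Hx]].
  { intros i Hi Hij. destruct (Hz (D + 1)%nat i ltac:(lia) Hi Hij); [left; assumption|right; lra]. }
  { assert (0 < Rabs c) by (apply Rabs_pos_lt; assumption). lra. }
  destruct (pseudo_poly_le_power d (fun i => alpha i * falling (theta i) (D + 2)) (fun i => theta i - INR (D + 2)) (theta j - INR (D + 2)))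
    as [E1 [HE1 HEx1]].
  { intros i Hi. destruct (Nat.eq_dec i j) as [->|Hij]; [right; lra|].
    destruct (Hz (D + 2)%nat i ltac:(lia) Hi Hij); [left; assumption|right; lra]. }
  destruct (pseudo_poly_le_power d alpha theta (INR D)) as [E2 [HE2 HEx2]].
  { intros i Hi; right; apply HtD; assumption. }
  exists D, (theta j), c, (E1 + E2), x0. repeat split; try assumption; try lra.
  - intros x Hxx. eapply Rle_trans; [apply HEx1; assumption|]. apply Rmult_le_compat_r; [left; apply Rpower_pos|lra].
  - apply pseudo_poly_nonneg; assumption.
  - eapply Rle_trans; [apply Rle_abs|]. eapply Rle_trans; [apply HEx2; assumption|].
    apply Rmult_le_compat_r; [left; apply Rpower_pos|lra].
Qed.

(** * The exponential sum estimate *)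

Lemma hprod_bounds (lo hi : R) hs : 0 <= lo ->
  Forall (fun h => lo <= INR h <= hi) hs -> lo ^ length hs <= hprod hs <= hi ^ length hs.
Proof.
  intros Hlo H; induction H as [|h hs Hh _ IH]; simpl; [lra|].
  assert (0 <= lo ^ length hs) by (apply pow_le; assumption).
  split; apply Rmult_le_compat; lra.
Qed.

Lemma hsum_le (hi : R) hs : Forall (fun h => INR h <= hi) hs -> hsum hs <= INR (length hs) * hi.
Proof.
  intros H; induction H as [|h hs Hh _ IH]; [simpl; lra|].
  cbn [length]; rewrite S_INR; simpl; lra.
Qed.

Lemma hprod_app hs hs' : hprod (hs ++ hs') = hprod hs * hprod hs'.
Proof. induction hs as [|h hs IH]; simpl; [ring|rewrite IH; ring]. Qed.

Lemma hsum_app hs hs' : hsum (hs ++ hs') = hsum hs + hsum hs'.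
Proof. induction hs as [|h hs IH]; simpl; [ring|rewrite IH; ring]. Qed.

Lemma iter_diff_rcons hs h F : iter_diff (hs ++ [h]) F = fdiff h (iter_diff hs F).
Proof. unfold iter_diff; rewrite fold_left_app; reflexivity. Qed.

(** Appending one or two unit shifts to [hs] turns the increments of the phase and their differences
    into iterated differences of orders [D + 1] and [D + 2]. The range [(2D + 4)P] adds up the base
    point [(1 + D)P], the index [P], the shifts [DP] and two unit steps, bounded by [2P]. *)
Lemma cos_sums_le_iter_diff F D hs P A B M lo hi w :
  derivative_tower F -> length hs = D -> 1 <= INR P ->
  Forall (fun h => lo <= INR h <= hi) hs -> 0 < lo -> hi <= INR P -> 0 < A ->
  (forall x, INR P <= x <= (2 * INR D + 4) * INR P -> A <= F (D + 1)%nat x <= B) ->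
  (forall x, INR P <= x <= (2 * INR D + 4) * INR P -> Rabs (F (D + 2)%nat x) <= M) ->
  hi ^ D * B <= 1 ->
  1 + 4 / (lo ^ D * A) + INR P * (4 * (hi ^ D * M) / ((lo ^ D * A) * (lo ^ D * A))) <= w * INR P ->
  cos_sums_le P (1 + INR D) w (iter_diff hs (F 0%nat)).
Proof.
  intros HF Hlen HP Hhs Hlo HhiP HA HAB HM HB Hfin a m c Ha Hm.
  assert (Hprod := hprod_bounds lo hi hs (Rlt_le _ _ Hlo) Hhs). rewrite Hlen in Hprod.
  assert (Hsum : hsum hs <= INR D * INR P).
  { rewrite <- Hlen; apply hsum_le. eapply Forall_impl; [|exact Hhs]. simpl; intros; lra. }
  assert (Hsum0 := hsum_nonneg hs).
  assert (Hm' : INR m <= INR P) by (apply le_INR; assumption).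
  assert (Hlop : 0 < lo ^ D) by (apply pow_lt; assumption).
  assert (HlA : 0 < lo ^ D * A) by (apply Rmult_lt_0_compat; assumption).
  assert (HM0 : 0 <= M).
  { eapply Rle_trans; [apply Rabs_pos|]. apply (HM (INR P)). generalize (pos_INR D). nra. }
  assert (HB0 : 0 < B).
  { assert (A <= F (D + 1)%nat (INR P) <= B) by (apply HAB; generalize (pos_INR D); nra). lra. }
  set (G := fun i => iter_diff hs (F 0%nat) (a + INR i)).
  assert (H1 : forall i, (i <= m)%nat -> hprod hs * A <= G (S i) - G i <= hprod hs * B).
  { intros i Hi.
    assert (INR i <= INR m) by (apply le_INR; assumption). assert (Hi0 := pos_INR i).
    replace (G (S i) - G i) with (iter_diff (hs ++ [1%nat]) (F 0%nat) (a + INR i)).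
    2:{ rewrite iter_diff_rcons; unfold fdiff, G. rewrite INR_1, S_INR.
        replace (a + INR i + 1) with (a + (INR i + 1)) by ring. reflexivity. }
    replace (hprod hs) with (hprod (hs ++ [1%nat])) by (rewrite hprod_app; simpl; ring).
    apply iter_diff_bounds; [assumption|lra|].
    rewrite length_app, hsum_app, Hlen; simpl length. simpl hsum.
    intros x Hx; apply HAB; nra. }
  assert (H2 : forall i, (i < m)%nat ->
     Rabs ((G (S (S i)) - G (S i)) - (G (S i) - G i)) <= hprod hs * M).
  { intros i Hi.
    assert (INR i <= INR m) by (apply le_INR; lia). assert (Hi0 := pos_INR i).
    replace (G (S (S i)) - G (S i) - (G (S i) - G i)) with (iter_diff (hs ++ [1%nat; 1%nat]) (F 0%nat) (a + INR i)).
    2:{ change [1%nat; 1%nat] with ([1%nat] ++ [1%nat]). rewrite app_assoc, !iter_diff_rcons.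
        unfold fdiff, G. rewrite INR_1, !S_INR.
        replace (a + INR i + 1) with (a + (INR i + 1)) by ring.
        replace (a + (INR i + 1) + 1) with (a + (INR i + 1 + 1)) by ring. reflexivity. }
    replace (hprod hs) with (hprod (hs ++ [1%nat; 1%nat])) by (rewrite hprod_app; simpl; ring).
    apply Rabs_le.
    replace (- (hprod (hs ++ [1%nat; 1%nat]) * M)) with (hprod (hs ++ [1%nat; 1%nat]) * - M) by ring.
    apply iter_diff_bounds; [assumption|lra|].
    rewrite length_app, hsum_app, Hlen; simpl length. simpl hsum.
    intros x Hx; apply Rabs_le_elim, HM; nra. }
  eapply Rle_trans; [|exact Hfin].
  eapply Rle_trans; [apply (kusmin_landau m G c (lo ^ D * A) (hi ^ D * M))|].
  - assumption.
  - intros i Hi; specialize (H1 i Hi).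
    assert (lo ^ D * A <= hprod hs * A) by (apply Rmult_le_compat_r; lra).
    assert (hprod hs * B <= hi ^ D * B) by (apply Rmult_le_compat_r; lra). lra.
  - intros i Hi; eapply Rle_trans; [apply H2; assumption|]. apply Rmult_le_compat_r; lra.
  - apply Rplus_le_compat_l, Rmult_le_compat_r; [|assumption].
    unfold Rdiv; apply Rmult_le_pos.
    + apply Rmult_le_pos; [lra|]. apply Rmult_le_pos; lra.
    + left; apply Rinv_0_lt_compat, Rmult_lt_0_compat; assumption.
Qed.

Lemma exists_nat_floor x : 1 <= x -> exists n : nat, (1 <= n)%nat /\ INR n <= x /\ x / 2 <= INR n /\ x < INR n + 1.
Proof.
  intros Hx. destruct (base_Int_part x) as [H1 H2].
  assert (H3 : (1 <= Int_part x)%Z).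
  { assert (0 < Int_part x)%Z by (apply lt_IZR; lra). lia. }
  exists (Z.to_nat (Int_part x)). rewrite INR_IZR_INZ, Z2Nat.id by lia.
  assert (1 <= IZR (Int_part x)) by (apply IZR_le; assumption).
  repeat split; [lia|lra|lra|lra].
Qed.

Lemma iter_sqrt_Rpower k p e : iter_sqrt k (Rpower p e) = Rpower p (e * (/ 2) ^ k).
Proof.
  unfold iter_sqrt; induction k as [|k IH]; simpl; [rewrite Rmult_1_r; reflexivity|].
  rewrite IH, <- Rpower_sqrt by apply Rpower_pos. rewrite Rpower_mult. f_equal; ring.
Qed.

Lemma Rpower_pow_mult x e n : Rpower x e ^ n = Rpower x (INR n * e).
Proof.
  rewrite <- Rpower_pow by apply Rpower_pos. rewrite Rpower_mult; f_equal; ring.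
Qed.

Lemma Rpower_anti a b e : 0 < a <= b -> e <= 0 -> Rpower b e <= Rpower a e.
Proof.
  intros Hab He. replace e with (- (- e)) by ring. rewrite !(Rpower_Ropp _ (- e)).
  apply Rinv_le_contravar; [apply Rpower_pos|apply Rle_Rpower_l; lra].
Qed.

(** The shifts run over [[p^(gam - kap), p^gam]]. The short end of this range and the freedom in
    [beta] lower the increments by at most [p^((D + 1) kap)]; [kap] is small enough for the
    Kusmin-Landau bound to stay below [p^(1 - kap/2)]. *)
Lemma cos_sum_power_saving_pos (g : nat -> R -> R) (D : nat) (T c E x0 : R) :
  derivative_tower g -> (1 <= D)%nat -> 1 < T < INR D -> 0 < c -> 0 < E ->
  (forall x, x0 <= x -> c * Rpower x (T - INR (D + 1)) <= g (D + 1)%nat x <= 3 * c * Rpower x (T - INR (D + 1))) ->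
  (forall x, 1 <= x -> Rabs (g (D + 2)%nat x) <= E * Rpower x (T - INR (D + 2))) ->
  exists kap rho p1, 0 < kap /\ 0 < rho /\ 1 <= p1 /\
  forall P : nat, p1 <= INR P -> forall beta, Rpower (INR P) (- kap) <= beta <= Rpower (INR P) kap ->
  forall z, rsum P (fun i => cos (2 * PI * beta * g 0%nat (INR P + INR i) + z)) <= 10 * Rpower (INR P) (1 - rho).
Proof.
  intros Hg HD HT Hc HE Hg1 Hg2.
  assert (HDr : 1 <= INR D) by (change 1 with (INR 1); apply le_INR; assumption).
  assert (HPI := PI_RGT_0).
  set (R0 := 2 * INR D + 4).
  set (kap := / (16 * (INR D + 1))).
  assert (Hkap : 0 < kap) by (apply Rinv_0_lt_compat; lra).
  assert (Hkap1 : kap * (INR D + 1) = / 16) by (unfold kap; field; lra).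
  set (gam := (INR D + / 2 - T) / INR D).
  assert (Hgam : INR D * gam = INR D + / 2 - T) by (unfold gam; field; lra).
  assert (Hgam0 : kap < gam) by (apply Rmult_lt_reg_l with (INR D); [lra|]; rewrite Hgam; nra).
  assert (Hgam1 : gam + kap / 2 <= 1).
  { apply Rmult_le_reg_l with (INR D); [lra|]. rewrite Rmult_plus_distr_l, Hgam. nra. }
  set (C1 := 2 * PI * c * Rpower R0 (T - INR (D + 1))).
  assert (HC1 : 0 < C1) by (unfold C1; apply Rmult_lt_0_compat; [nra|apply Rpower_pos]).
  (* The constants of the three Kusmin-Landau terms, later absorbed by [p^(1/4)]. *)
  set (K0 := 1 + 4 / C1 + 8 * PI * E / (C1 * C1)).
  destruct (Rpower_ge_const (6 * PI * c) (/ 2 - kap)) as [q1 [Hq1 Hbig1]]; [nra|].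
  destruct (Rpower_ge_const K0 (/ 4)) as [q2 [Hq2 Hbig2]]; [lra|].
  destruct (Rpower_ge_const 4 (kap / 2)) as [q3 [Hq3 Hbig3]]; [lra|].
  (* [D] square roots of [w = p^(-kap/2)]. *)
  exists kap, (kap / 2 * (/ 2) ^ D), (Rmax (Rmax q1 q2) (Rmax q3 x0)).
  assert (Hpow : 0 < (/ 2) ^ D) by (apply pow_lt; lra).
  split; [assumption|]. split; [apply Rmult_lt_0_compat; lra|].
  split; [apply Rle_trans with q1; [assumption|]; eapply Rle_trans; [apply Rmax_l|apply Rmax_l]|].
  intros P HP beta Hbeta z.
  assert (HP1 : q1 <= INR P) by (eapply Rle_trans; [|exact HP]; eapply Rle_trans; [apply Rmax_l|apply Rmax_l]).
  assert (HP2 : q2 <= INR P) by (eapply Rle_trans; [|exact HP]; eapply Rle_trans; [apply Rmax_r|apply Rmax_l]).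
  assert (HP3 : q3 <= INR P) by (eapply Rle_trans; [|exact HP]; eapply Rle_trans; [apply Rmax_l|apply Rmax_r]).
  assert (HPx : x0 <= INR P) by (eapply Rle_trans; [|exact HP]; eapply Rle_trans; [apply Rmax_r|apply Rmax_r]).
  specialize (Hbig1 _ HP1); specialize (Hbig2 _ HP2); specialize (Hbig3 _ HP3).
  set (p := INR P) in *.
  assert (Hp : 1 <= p) by lra.
  assert (Hb0 : 0 < beta) by (generalize (Rpower_pos p (- kap)); lra).
  assert (Hge1 : forall e, 0 <= e -> 1 <= Rpower p e).
  { intros e He. rewrite <- (Rpower_O p) by lra. apply Rle_Rpower; lra. }
  destruct (exists_nat_floor (Rpower p gam)) as [H [HH1 [HHu [HHl _]]]]; [apply Hge1; lra|].
  destruct (exists_nat_floor (Rpower p (gam - kap))) as [H' [_ [HHu0 [_ HHl0]]]]; [apply Hge1; lra|].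
  assert (Hone := Hge1 (gam - kap) ltac:(lra)).
  set (w := Rpower p (- (kap / 2))).
  assert (Hw : 0 <= w <= 1).
  { split; [left; apply Rpower_pos|]. unfold w; rewrite Rpower_Ropp, <- Rinv_1.
    apply Rinv_le_contravar; [lra|apply Hge1; lra]. }
  assert (Hpp : forall e, Rpower p e * p = Rpower p (e + 1)) by (intros; rewrite Rpower_plus, (Rpower_1 p) by lra; reflexivity).
  assert (HHP : INR H <= w * p).
  { eapply Rle_trans; [exact HHu|]. unfold w; rewrite Hpp. apply Rle_Rpower; lra. }
  (* The successor makes the cutoff exceed [p^(gam - kap)]. Rounding costs a factor 2 on each side,
     paid by [p^(kap/2) >= 4]. *)
  assert (HH0 : INR (S H') <= w * INR H).
  { rewrite S_INR. apply Rle_trans with (2 * Rpower p (gam - kap)); [lra|].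
    apply Rle_trans with (w * (Rpower p gam / 2)); [|apply Rmult_le_compat_l; lra].
    replace (w * (Rpower p gam / 2)) with (/2 * (Rpower p (kap / 2) * Rpower p (gam - kap))).
    - nra.
    - transitivity (/ 2 * Rpower p (- (kap / 2) + gam)).
      + rewrite <- Rpower_plus; f_equal; f_equal; field.
      + rewrite Rpower_plus; unfold w; field. }
  assert (Hfin : cos_sums_le P 1 (10 * iter_sqrt D w) (fun x => 2 * PI * beta * g 0%nat x)).
  { apply (cos_sums_le_weyl P (S H') H w D); try assumption.
    intros hs Hlen Hhs.
    set (lo := Rpower p (gam - kap)); set (hi := Rpower p gam).
    set (A := 2 * PI * beta * (c * Rpower (R0 * p) (T - INR (D + 1)))).
    set (B := 2 * PI * beta * (3 * c * Rpower p (T - INR (D + 1)))).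
    set (M := 2 * PI * beta * (E * Rpower p (T - INR (D + 2)))).
    assert (H2pb : 0 < 2 * PI * beta) by nra.
    assert (HT1 : T - INR (D + 1) <= 0) by (rewrite plus_INR; simpl; lra).
    assert (HT2 : T - INR (D + 2) <= 0) by (rewrite plus_INR; simpl; lra).
    assert (HA0 : 0 < A) by (unfold A; apply Rmult_lt_0_compat; [assumption|]; apply Rmult_lt_0_compat; [assumption|apply Rpower_pos]).
    apply (cos_sums_le_iter_diff (fun k x => 2 * PI * beta * g k x) D hs P A B M lo hi w).
    - apply derivative_tower_scal; assumption.
    - assumption.
    - assumption.
    - eapply Forall_impl; [|exact Hhs]. intros h [Ha Hb]. cbv beta.
      apply le_INR in Ha; apply le_INR in Hb. rewrite S_INR in Ha. unfold lo, hi; lra.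
    - apply Rpower_pos.
    - unfold hi. fold p. rewrite <- (Rpower_1 p) at 2 by lra. apply Rle_Rpower; lra.
    - assumption.
    - fold p. intros x Hx. specialize (Hg1 x ltac:(lra)). unfold A, B.
      assert (Rpower (R0 * p) (T - INR (D + 1)) <= Rpower x (T - INR (D + 1))) by (apply Rpower_anti; [unfold R0; lra|assumption]).
      assert (Rpower x (T - INR (D + 1)) <= Rpower p (T - INR (D + 1))) by (apply Rpower_anti; [lra|assumption]).
      split; apply Rmult_le_compat_l; nra.
    - fold p. intros x Hx. specialize (Hg2 x ltac:(lra)). unfold M.
      rewrite Rabs_mult, (Rabs_right (2 * PI * beta)) by lra.
      apply Rmult_le_compat_l; [lra|]. eapply Rle_trans; [exact Hg2|]. apply Rmult_le_compat_l; [lra|].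
      apply Rpower_anti; [lra|assumption].
    - unfold hi, B. rewrite Rpower_pow_mult, Hgam.
      apply Rle_trans with (6 * PI * c * Rpower p (kap - / 2)).
      + replace (kap - / 2) with (kap + ((INR D + / 2 - T) + (T - INR (D + 1)))) by (rewrite plus_INR; simpl; field).
        rewrite !Rpower_plus.
        assert (0 < Rpower p (INR D + / 2 - T)) by apply Rpower_pos.
        assert (0 < Rpower p (T - INR (D + 1))) by apply Rpower_pos.
        set (X := Rpower p (INR D + / 2 - T)) in *; set (Y := Rpower p (T - INR (D + 1))) in *.
        replace (X * (2 * PI * beta * (3 * c * Y))) with (6 * PI * c * (beta * (X * Y))) by ring.
        apply Rmult_le_compat_l; [nra|]. apply Rmult_le_compat_r; [nra|lra].
      + replace (kap - / 2) with (- (/ 2 - kap)) by ring. rewrite Rpower_Ropp.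
        assert (0 < Rpower p (/ 2 - kap)) by apply Rpower_pos.
        apply Rmult_le_reg_r with (Rpower p (/ 2 - kap)); [assumption|].
        rewrite Rmult_assoc, Rinv_l by lra. lra.
    - fold p.
      set (lam := C1 * Rpower p (- / 2 - (INR D + 1) * kap)).
      assert (Hlam : 0 < lam) by (apply Rmult_lt_0_compat; [assumption|apply Rpower_pos]).
      assert (HlA : lam <= lo ^ D * A).
      { unfold lam, lo, A, C1. rewrite Rpower_pow_mult, <- Rpower_mult_distr by (unfold R0; lra).
        replace (- / 2 - (INR D + 1) * kap) with (- kap + (INR D * (gam - kap) + (T - INR (D + 1)))).
        2:{ rewrite Rmult_minus_distr_l, Hgam, plus_INR; simpl; field. }
        rewrite !Rpower_plus.
        set (X := Rpower p (INR D * (gam - kap))); set (Y := Rpower p (T - INR (D + 1))); set (Z := Rpower R0 (T - INR (D + 1))).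
        assert (0 < X) by apply Rpower_pos; assert (0 < Y) by apply Rpower_pos; assert (0 < Z) by apply Rpower_pos.
        replace (2 * PI * c * Z * (Rpower p (- kap) * (X * Y))) with (2 * PI * c * Z * X * Y * Rpower p (- kap)) by ring.
        replace (X * (2 * PI * beta * (c * (Z * Y)))) with (2 * PI * c * Z * X * Y * beta) by ring.
        apply Rmult_le_compat_l; [|lra].
        assert (0 < 2 * PI * c) by nra.
        apply Rmult_le_pos; [apply Rmult_le_pos; [apply Rmult_le_pos|]|]; lra. }
      set (mu := 2 * PI * E * Rpower p (kap - 3 / 2)).
      assert (Hmu : hi ^ D * M <= mu).
      { unfold mu, hi, M. rewrite Rpower_pow_mult, Hgam.
        replace (kap - 3 / 2) with (kap + ((INR D + / 2 - T) + (T - INR (D + 2)))) by (rewrite plus_INR; simpl; field).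
        rewrite !Rpower_plus.
        set (X := Rpower p (INR D + / 2 - T)); set (Y := Rpower p (T - INR (D + 2))).
        assert (0 < X) by apply Rpower_pos; assert (0 < Y) by apply Rpower_pos.
        replace (X * (2 * PI * beta * (E * Y))) with (2 * PI * E * (beta * (X * Y))) by ring.
        apply Rmult_le_compat_l; [nra|]. apply Rmult_le_compat_r; [nra|lra]. }
      assert (HM0 : 0 <= hi ^ D * M).
      { unfold M, hi. apply Rmult_le_pos; [apply pow_le; left; apply Rpower_pos|].
        apply Rmult_le_pos; [lra|]. apply Rmult_le_pos; [lra|left; apply Rpower_pos]. }
      apply Rle_trans with (1 + 4 / lam + p * (4 * mu / (lam * lam))).
      { apply Rplus_le_compat; [apply Rplus_le_compat_l|apply Rmult_le_compat_l; [lra|]].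
        - unfold Rdiv; apply Rmult_le_compat_l; [lra|]. apply Rinv_le_contravar; assumption.
        - unfold Rdiv; apply Rmult_le_compat; [lra| |lra|].
          + left; apply Rinv_0_lt_compat, Rmult_lt_0_compat; lra.
          + apply Rinv_le_contravar; [apply Rmult_lt_0_compat; assumption|].
            apply Rmult_le_compat; lra. }
      (* The exponent of [p * mu / lam^2], where [mu] has exponent [kap - 3/2] and [lam] has
         exponent [-1/2 - (D + 1) kap]. *)
      set (e := / 2 + (2 * INR D + 3) * kap).
      apply Rle_trans with (K0 * Rpower p e).
      { unfold K0. rewrite !Rmult_plus_distr_r, Rmult_1_l.
        apply Rplus_le_compat; [apply Rplus_le_compat|].
        - apply Hge1. unfold e; nra.
        - unfold lam, Rdiv. rewrite Rinv_mult, <- Rmult_assoc. apply Rmult_le_compat_l.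
          + apply Rmult_le_pos; [lra|left; apply Rinv_0_lt_compat; assumption].
          + rewrite <- Rpower_Ropp. apply Rle_Rpower; [assumption|]. unfold e; nra.
        - right. unfold lam, mu, e, Rdiv. rewrite !Rinv_mult, <- !Rpower_Ropp.
          replace (/ 2 + (2 * INR D + 3) * kap) with ((kap - 3 * / 2) + (1 + (- (- / 2 - (INR D + 1) * kap) + - (- / 2 - (INR D + 1) * kap)))) by field.
          rewrite !Rpower_plus, Rpower_1 by lra. field; lra. }
      unfold w; rewrite Hpp.
      apply Rle_trans with (Rpower p (/ 4) * Rpower p e).
      + apply Rmult_le_compat_r; [left; apply Rpower_pos|assumption].
      + rewrite <- Rpower_plus. apply Rle_Rpower; [assumption|]. unfold e; nra. }
  specialize (Hfin p P z). fold p in Hfin.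
  eapply Rle_trans; [apply Hfin; [lra|lia]|].
  unfold w; rewrite iter_sqrt_Rpower, Rmult_assoc, Hpp. right; f_equal; f_equal. ring.
Qed.

(** Signs are removed: [sg] makes the leading coefficient positive, and a negative frequency is
    conjugated away by replacing [z] with [- z], the cosine being even. *)
Lemma cos_sum_power_saving (d : nat) (alpha theta : nat -> R) : is_pseudo_poly d alpha theta ->
  exists kap rho p1, 0 < kap /\ 0 < rho /\ 1 <= p1 /\
  forall P : nat, p1 <= INR P ->
  forall beta, Rpower (INR P) (- kap) <= Rabs beta <= Rpower (INR P) kap ->
  forall z, rsum P (fun i => cos (2 * PI * beta * pseudo_poly d alpha theta (INR P + INR i) + z))
    <= 10 * Rpower (INR P) (1 - rho).
Proof.
  intros Hpp. destruct (pseudo_poly_structure d alpha theta Hpp)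
    as [D [T [c [E [x0 [HD [HT [Hc [HE [Hx0 [H1 [H2 _]]]]]]]]]]]].
  set (sg := if Rle_dec 0 c then 1 else -1).
  assert (Hsg : sg * c = Rabs c /\ (sg = 1 \/ sg = -1)).
  { unfold sg; destruct (Rle_dec 0 c).
    - rewrite Rabs_right by lra. split; [ring|left; reflexivity].
    - rewrite Rabs_left by lra. split; [ring|right; reflexivity]. }
  destruct Hsg as [Hsc Hsg].
  assert (Hc0 : 0 < Rabs c) by (apply Rabs_pos_lt; assumption).
  destruct (cos_sum_power_saving_pos (fun k x => sg * pp_deriv d alpha theta k x) D T (Rabs c / 2) E x0)
    as [kap [rho [p1 [Hk [Hr [Hp1 Hmain]]]]]]; try assumption; try lra.
  - apply derivative_tower_scal, derivative_tower_pp.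
  - intros x Hx. specialize (H1 x Hx). apply Rabs_le_elim in H1.
    set (X := Rpower x (T - INR (D + 1))) in *. set (Y := pp_deriv d alpha theta (D + 1) x) in *.
    assert (sg * (c * X) = Rabs c * X) by (rewrite <- Rmult_assoc, Hsc; reflexivity).
    destruct Hsg as [Hs|Hs]; rewrite Hs in *; lra.
  - intros x Hx. rewrite Rabs_mult. replace (Rabs sg) with 1; [rewrite Rmult_1_l; apply H2; assumption|].
    destruct Hsg as [->| ->]; [rewrite Rabs_right; lra|rewrite Rabs_left; lra].
  - exists kap, rho, p1; split; [assumption|split; [assumption|split; [assumption|]]].
    intros P HP beta Hbeta z.
    assert (Hcase : beta = Rabs beta * sg \/ beta = - (Rabs beta * sg)).
    { destruct Hsg as [-> | ->]; destruct (Rle_dec 0 beta);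
        (rewrite Rabs_right by lra) || (rewrite Rabs_left by lra); lra. }
    destruct Hcase as [Hcs|Hcs].
    + eapply Rle_trans; [right|apply (Hmain P HP (Rabs beta) Hbeta z)].
      apply rsum_ext; intros i _. rewrite pp_deriv_0, Hcs at 1. f_equal.
      replace (Rabs (Rabs beta * sg)) with (Rabs beta) by (rewrite <- Hcs; reflexivity). ring.
    + eapply Rle_trans; [right|apply (Hmain P HP (Rabs beta) Hbeta (- z))].
      apply rsum_ext; intros i _. rewrite pp_deriv_0, Hcs at 1. rewrite <- cos_neg. f_equal.
      replace (Rabs (- (Rabs beta * sg))) with (Rabs beta) by (rewrite <- Hcs; reflexivity). ring.
Qed.

(** * Diophantine approximation *)

Lemma dist_nint_le x (z : Z) : dist_nint x <= Rabs (x - IZR z).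
Proof.
  unfold dist_nint, rfloor. destruct (base_Int_part x) as [H1 H2].
  destruct (Z.le_gt_cases z (Int_part x)) as [Hz|Hz].
  - apply Rle_trans with (x - IZR (Int_part x)); [apply Rmin_l|].
    apply IZR_le in Hz. eapply Rle_trans; [|apply Rle_abs]. lra.
  - apply Rle_trans with (IZR (Int_part x) + 1 - x); [apply Rmin_r|].
    assert (Hz' : (Int_part x + 1 <= z)%Z) by lia. apply IZR_le in Hz'. rewrite plus_IZR in Hz'.
    rewrite Rabs_minus_sym. eapply Rle_trans; [|apply Rle_abs]. lra.
Qed.

Lemma cos_sub_2PI_Z x (z : Z) : cos (2 * PI * (x - IZR z)) = cos (2 * PI * x).
Proof.
  destruct (Z.le_ge_cases 0 z) as [Hz|Hz].
  - rewrite <- (cos_period _ (Z.to_nat z)). f_equal. rewrite INR_IZR_INZ, Z2Nat.id by lia. ring.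
  - rewrite <- (cos_period (2 * PI * x) (Z.to_nat (- z))). f_equal.
    rewrite INR_IZR_INZ, Z2Nat.id, opp_IZR by lia. ring.
Qed.

Lemma near_int_of_cos x eps : 0 <= eps <= / 2 -> cos (2 * PI * eps) < cos (2 * PI * x) ->
  exists z : Z, Rabs (x - IZR z) < eps.
Proof.
  intros He Hc. exists (Int_part (x + / 2)).
  destruct (base_Int_part (x + / 2)) as [H1 H2].
  rewrite <- (cos_sub_2PI_Z x (Int_part (x + / 2))) in Hc.
  set (y := x - IZR (Int_part (x + / 2))) in *.
  assert (Hy : Rabs y <= / 2) by (apply Rabs_le; unfold y; lra).
  assert (HPI := PI_RGT_0). assert (Hy0 := Rabs_pos y).
  assert (Hc' : cos (2 * PI * eps) < cos (2 * PI * Rabs y)).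
  { destruct (Rle_dec 0 y); [rewrite Rabs_right by lra; assumption|].
    rewrite Rabs_left, Ropp_mult_distr_r_reverse, cos_neg by lra. assumption. }
  apply cos_decreasing_0 in Hc'; nra.
Qed.

(** The right side is [2 sin^2(PI eps)], and [sin(PI eps) >= PI eps / 2 >= 3 eps / 2]. *)
Lemma one_sub_cos_lower eps : 0 <= eps <= / 4 -> 4 * (eps * eps) <= 1 - cos (2 * PI * eps).
Proof.
  intros He. assert (H1 := PI2_3_2). assert (H2 := PI_4).
  assert (Hs := sin_lower (PI * eps) ltac:(nra)).
  rewrite Rmult_assoc, cos_2a_sin.
  assert (3 / 2 * eps <= sin (PI * eps)) by nra. nra.
Qed.

(** A box of radius [eps] gives a gain [4 eps^2], so the loss [2 / K] requires [K] about [eps^(-2)];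
    this is the range of [u] and [v]. The error [4 K^2 sigma] then demands [80 p^(-rho) < eps^6],
    with [rho] the saving of the exponential sums. Admitting [eps >= p^(-rho/12)] leaves a spare
    [p^(rho/2)], which exceeds 80. *)
Lemma exists_simultaneous_approx (d : nat) (alpha theta : nat -> R) : is_pseudo_poly d alpha theta ->
  exists kap rho p1, 0 < kap /\ 0 < rho /\ 1 <= p1 /\
  forall P : nat, p1 <= INR P ->
  forall eps, Rpower (INR P) (- rho) <= eps <= / 4 ->
  forall b1 b2 s t : R,
  (forall u v : Z, Rabs (IZR u) <= 2 / (eps * eps) -> Rabs (IZR v) <= 2 / (eps * eps) -> (u <> 0 \/ v <> 0)%Z ->
     Rpower (INR P) (- kap) <= Rabs (IZR u * b1 + IZR v * b2) <= Rpower (INR P) kap) ->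
  exists (n : nat) (z z' : Z), (P <= n < 2 * P)%nat /\
    Rabs (b1 * pseudo_poly d alpha theta (INR n) - s - IZR z) < eps /\
    Rabs (b2 * pseudo_poly d alpha theta (INR n) - t - IZR z') < eps.
Proof.
  intros Hpp. destruct (cos_sum_power_saving d alpha theta Hpp) as [kap [rho [p1 [Hk [Hr [Hp1 Hsum]]]]]].
  destruct (Rpower_ge_const 81 (rho / 2)) as [q1 [Hq1 Hbig]]; [lra|].
  exists kap, (rho / 12), (Rmax p1 q1). split; [assumption|]. split; [lra|].
  split; [apply Rle_trans with p1; [assumption|apply Rmax_l]|].
  intros P HP eps Heps b1 b2 s t Huv.
  assert (HP1 : p1 <= INR P) by (eapply Rle_trans; [apply Rmax_l|exact HP]).
  assert (HP2 : q1 <= INR P) by (eapply Rle_trans; [apply Rmax_r|exact HP]).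
  specialize (Hbig _ HP2). set (p := INR P) in *.
  set (f := fun i => pseudo_poly d alpha theta (p + INR i)).
  assert (He0 : 0 < eps) by (generalize (Rpower_pos p (- (rho / 12))); lra).
  assert (Hx1 : 1 <= / (eps * eps)).
  { rewrite <- Rinv_1. apply Rinv_le_contravar; nra. }
  destruct (exists_nat_floor (/ (eps * eps)) Hx1) as [k [Hk1 [Hk2 [_ Hk3]]]].
  set (K := S k).
  assert (HKr : / (eps * eps) <= INR K <= 2 / (eps * eps)) by (unfold K; rewrite S_INR; unfold Rdiv; lra).
  assert (HKZ : forall u, (Z.abs u <= Z.of_nat K)%Z -> Rabs (IZR u) <= 2 / (eps * eps)).
  { intros u Hu. rewrite <- abs_IZR. apply Rle_trans with (INR K); [|lra].
    rewrite INR_IZR_INZ. apply IZR_le; assumption. }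
  set (sigma := 10 * Rpower p (1 - rho)).
  assert (Hsig : 0 < sigma) by (unfold sigma; generalize (Rpower_pos p (1 - rho)); lra).
  destruct (exists_in_box P K (fun i => b1 * f i - s) (fun i => b2 * f i - t) sigma eps) as [i [Hi [Hc1 Hc2]]].
  - unfold K; lia.
  - lra.
  - intros u v Hu Hv Hn0.
    specialize (Huv u v (HKZ u Hu) (HKZ v Hv) Hn0).
    set (z := - (2 * PI * (IZR u * s + IZR v * t))).
    apply Rabs_le; split.
    (* A phase shift by [PI] changes the sign of every term, so the one-sided bound also gives the
       lower one. *)
    + assert (H := Hsum P HP1 _ Huv (z + PI)).
      rewrite (rsum_ext P _ (fun i => -1 * cos (2 * PI * (IZR u * (b1 * f i - s) + IZR v * (b2 * f i - t))))) in H.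
      * rewrite rsum_scal in H. fold p sigma in H. lra.
      * intros i _. rewrite <- Rplus_assoc, neg_cos. fold p. fold (f i).
        replace (2 * PI * (IZR u * b1 + IZR v * b2) * f i + z) with
          (2 * PI * (IZR u * (b1 * f i - s) + IZR v * (b2 * f i - t))) by (unfold z; ring). ring.
    + assert (H := Hsum P HP1 _ Huv z). fold p sigma in H.
      eapply Rle_trans; [right|exact H]. apply rsum_ext; intros i _. fold (f i). f_equal. unfold z; ring.
  - fold p. assert (Hcos := one_sub_cos_lower eps ltac:(lra)).
    assert (HK2 : 2 / INR K <= 2 * (eps * eps)).
    { unfold Rdiv; apply Rmult_le_compat_l; [lra|]. rewrite <- (Rinv_inv (eps * eps)).
      apply Rinv_le_contravar; lra. }
    apply Rlt_le_trans with (p * (2 * (eps * eps))); [|apply Rmult_le_compat_l; lra].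
    assert (Hee : 0 < eps * eps) by nra.
    apply Rle_lt_trans with (4 * (2 / (eps * eps)) ^ 2 * sigma).
    { apply Rmult_le_compat_r; [lra|]. apply Rmult_le_compat_l; [lra|]. apply pow_incr.
      assert (0 <= INR K) by apply pos_INR. lra. }
    assert (He6 : Rpower p (- (rho / 2)) <= eps ^ 6).
    { apply Rle_trans with (Rpower p (- (rho / 12)) ^ 6).
      - rewrite Rpower_pow_mult. right; f_equal. simpl; field.
      - apply pow_incr. split; [left; apply Rpower_pos|lra]. }
    assert (Hsm : 160 * Rpower p (- rho) < 2 * eps ^ 6).
    { apply Rlt_le_trans with (2 * Rpower p (- (rho / 2))); [|lra].
      replace (- rho) with (- (rho / 2) + - (rho / 2)) by field. rewrite Rpower_plus, (Rpower_Ropp p (rho / 2)).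
      set (Y := Rpower p (rho / 2)) in *. assert (0 < / Y) by (apply Rinv_0_lt_compat; lra).
      assert (Y * / Y = 1) by (apply Rinv_r; lra). nra. }
    unfold sigma. unfold Rminus; rewrite Rpower_plus, Rpower_1 by lra.
    apply Rmult_lt_reg_r with (eps ^ 4); [apply pow_lt; assumption|].
    replace (4 * (2 / (eps * eps)) ^ 2 * (10 * (p * Rpower p (- rho))) * eps ^ 4) with (p * (160 * Rpower p (- rho))) by (field; lra).
    replace (p * (2 * (eps * eps)) * eps ^ 4) with (p * (2 * eps ^ 6)) by ring.
    apply Rmult_lt_compat_l; lra.
  - destruct (near_int_of_cos _ eps ltac:(lra) Hc1) as [z Hz].
    destruct (near_int_of_cos _ eps ltac:(lra) Hc2) as [z' Hz'].
    exists (P + i)%nat, z, z'. rewrite plus_INR. fold p. fold (f i).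
    split; [lia|]. split; assumption.
Qed.

Lemma rfloor_unique x (z : Z) : IZR z <= x < IZR z + 1 -> rfloor x = IZR z.
Proof. intros H; unfold rfloor; f_equal; symmetry; apply Int_part_spec; lra. Qed.

(* A second coefficient [/ (64 q^3)] so small that it cannot interfere with [u / q] reduces the
   one-dimensional problem to simultaneous approximation. *)
Lemma exists_floor_multiple (d : nat) (alpha theta : nat -> R) : is_pseudo_poly d alpha theta ->
  exists del p1, 0 < del /\ 1 <= p1 /\
  forall W : nat, p1 <= INR W -> forall q : Z, (1 <= q)%Z -> 64 * IZR q ^ 3 <= Rpower (INR W) del ->
  exists (n : nat) (z : Z), (W <= n < 2 * W)%nat /\
    rfloor (pseudo_poly d alpha theta (INR n)) = IZR q * IZR z.
Proof.
  intros Hpp. destruct (exists_simultaneous_approx d alpha theta Hpp) as [kap [rho [p1 [Hk [Hr [Hp1 Hap]]]]]].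
  exists (Rmin kap rho), p1. split; [apply Rmin_glb_lt; assumption|]. split; [assumption|].
  intros W HW q Hq Hqw. apply IZR_le in Hq. set (Q := IZR q) in *.
  (* With exponent [kap] this keeps the linear forms above [W^(-kap)]; with [rho] it makes the
     radius [1 / (4q)] admissible. *)
  assert (Hk' : 64 * Q ^ 3 <= Rpower (INR W) kap).
  { eapply Rle_trans; [exact Hqw|]. apply Rle_Rpower; [lra|apply Rmin_l]. }
  assert (Hr' : 64 * Q ^ 3 <= Rpower (INR W) rho).
  { eapply Rle_trans; [exact Hqw|]. apply Rle_Rpower; [lra|apply Rmin_r]. }
  assert (HQ2 : Q <= Q ^ 2) by nra. assert (HQ3 : Q ^ 2 <= Q ^ 3) by nra.
  assert (Hinv : forall e, 64 * Q ^ 3 <= Rpower (INR W) e -> Rpower (INR W) (- e) <= / (64 * Q ^ 3)).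
  { intros e He. rewrite Rpower_Ropp. apply Rinv_le_contravar; lra. }
  set (eps := / (4 * Q)). set (tau := / (64 * Q ^ 3)).
  assert (Htau : 0 < tau) by (apply Rinv_0_lt_compat; lra).
  (* [32 q^2] is the frequency bound [2 / eps^2], so [v * tau] never exceeds half of [1 / q]. *)
  assert (HQt : 32 * Q ^ 2 * tau = / (2 * Q)) by (unfold tau; field; lra).
  assert (HQi : 0 < / (2 * Q) <= / 2).
  { split; [apply Rinv_0_lt_compat; lra|apply Rinv_le_contravar; lra]. }
  assert (HQi' : / Q = 2 * / (2 * Q)) by (field; lra).
  assert (Htq : tau <= / (2 * Q)) by (apply Rinv_le_contravar; lra).
  assert (Heps2 : 2 / (eps * eps) = 32 * Q ^ 2) by (unfold eps; field; lra).
  (* Centring at [eps] puts [F / q] strictly between [z] and [z + 1 / (2q)], so [F] lies between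
     [q z] and [q z + 1/2]. *)
  destruct (Hap W HW eps) with (b1 := / Q) (b2 := tau) (s := eps) (t := 0) as [n [z [z' [Hn [Hz _]]]]].
  - split; [|apply Rinv_le_contravar; lra].
    eapply Rle_trans; [apply Hinv; assumption|]. apply Rinv_le_contravar; lra.
  - rewrite Heps2. intros u v Hu Hv Hn0.
    assert (Hone : forall k : Z, (k <> 0)%Z -> 1 <= Rabs (IZR k)).
    { intros k Hk0. rewrite <- abs_IZR. apply IZR_le. lia. }
    assert (Hvt : Rabs (IZR v * tau) <= / (2 * Q)).
    { rewrite Rabs_mult, (Rabs_right tau), <- HQt by lra. apply Rmult_le_compat_r; lra. }
    assert (Hut : Rabs (IZR u * / Q) = Rabs (IZR u) * / Q).
    { rewrite Rabs_mult, (Rabs_right (/ Q)) by lra. reflexivity. }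
    split.
    + apply Rle_trans with tau; [apply Hinv; assumption|].
      destruct (Z.eq_dec u 0) as [->|Hu0].
      * rewrite Rmult_0_l, Rplus_0_l, Rabs_mult, (Rabs_right tau) by lra.
        assert (1 <= Rabs (IZR v)) by (apply Hone; lia). nra.
      * specialize (Hone u Hu0).
        assert (/ Q <= Rabs (IZR u * / Q)) by (rewrite Hut; nra).
        replace (IZR u * / Q) with ((IZR u * / Q + IZR v * tau) - IZR v * tau) in H by ring.
        assert (H' := Rabs_triang (IZR u * / Q + IZR v * tau) (- (IZR v * tau))).
        rewrite Rabs_Ropp in H'. unfold Rminus in H. lra.
    + eapply Rle_trans; [apply Rabs_triang|]. rewrite Hut.
      assert (Rabs (IZR u) * / Q <= Rabs (IZR u)) by (generalize (Rabs_pos (IZR u)); nra). lra.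
  - exists n, z. split; [assumption|]. unfold Q; rewrite <- mult_IZR. apply rfloor_unique.
    rewrite mult_IZR; fold Q. apply Rabs_def2 in Hz. unfold eps in Hz.
    set (F := pseudo_poly d alpha theta (INR n)) in *.
    assert (HF : F = Q * (/ Q * F)) by (field; lra).
    assert (Hq4 : Q * / (4 * Q) = / 4) by (field; lra).
    set (y := / Q * F) in *. rewrite HF.
    assert (IZR z < y) by lra. assert (y < IZR z + 2 * / (4 * Q)) by lra. nra.
Qed.

(** * The choice of parameters and the two cases for [xi] *)

Lemma eventually_and (Q1 Q2 : R -> Prop) :
  (exists x1, forall x, x1 <= x -> Q1 x) -> (exists x2, forall x, x2 <= x -> Q2 x) ->
  exists x0, forall x, x0 <= x -> Q1 x /\ Q2 x.
Proof.
  intros [x1 H1] [x2 H2]. exists (Rmax x1 x2). intros x Hx. split; [apply H1|apply H2].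
  - eapply Rle_trans; [apply Rmax_l|exact Hx].
  - eapply Rle_trans; [apply Rmax_r|exact Hx].
Qed.

Lemma eventually_ge x0 : exists x1, forall x : R, x1 <= x -> x0 <= x.
Proof. exists x0; trivial. Qed.

Lemma eventually_Rpower_ge C e : 0 < e -> exists x1, forall x, x1 <= x -> C <= Rpower x e.
Proof. intros He; destruct (Rpower_ge_const C e He) as [x0 [_ H]]; exists x0; exact H. Qed.

Theorem theorem2p6 (d : nat) (alpha theta : nat -> R) :
  is_pseudo_poly d alpha theta ->
  exists eta C : R, 0 < eta /\ 0 < C /\
    forall xi : R, exists N0 : nat, forall N : nat, (N0 <= N)%nat ->
      exists n : nat, (1 <= n)%nat /\ (n <= N)%nat /\
        dist_nint (xi * rfloor (pseudo_poly d alpha theta (INR n)))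
          <= C * Rpower (INR N) (- eta).
Proof.
  intros Hpp.
  destruct (pseudo_poly_structure d alpha theta Hpp) as [D [_ [_ [E [_ [HD [_ [_ [HE [_ [_ [_ Hf]]]]]]]]]]]].
  destruct (exists_simultaneous_approx d alpha theta Hpp) as [kap [rho [p1 [Hk [Hr [Hp1 Hap]]]]]].
  destruct (exists_floor_multiple d alpha theta Hpp) as [del [p2 [Hdel [Hp2 Hmul]]]].
  assert (HDr : 1 <= INR D) by (change 1 with (INR 1); apply le_INR; assumption).
  (* [sc] is chosen so that [p^(-kap) f(2 p^sc)] is still small *)
  set (sc := Rmin 1 kap / (4 * INR D)).
  assert (Hm1 : 0 < Rmin 1 kap) by (apply Rmin_glb_lt; lra).
  assert (Hm1l := Rmin_l 1 kap). assert (Hm1r := Rmin_r 1 kap).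
  assert (HscD : sc * INR D = Rmin 1 kap / 4) by (unfold sc; field; lra).
  assert (Hsc0 : 0 < sc) by (unfold sc; apply Rdiv_lt_0_compat; lra).
  assert (Hsc1 : sc <= 1 / 4) by nra.
  set (m := Rmin (Rmin kap rho) (sc * del)).
  assert (Hm0 : 0 < m).
  { unfold m; repeat apply Rmin_glb_lt; try assumption. apply Rmult_lt_0_compat; assumption. }
  assert (Hmk : m <= kap) by (unfold m; eapply Rle_trans; [apply Rmin_l|apply Rmin_l]).
  assert (Hmr : m <= rho) by (unfold m; eapply Rle_trans; [apply Rmin_l|apply Rmin_r]).
  assert (Hmd : m <= sc * del) by (unfold m; apply Rmin_r).
  set (e1 := m / 32). assert (He1 : 0 < e1) by (unfold e1; lra).
  (* Half of [e1] absorbs the factor [1 + 2 |xi|]; the other half is halved again in passing from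
     [p] to [N <= 3p <= p^2]. *)
  exists (e1 / 4), 1. split; [lra|]. split; [lra|]. intros xi.
  destruct (eventually_and _ _ (eventually_ge 3)
    (eventually_and _ _ (eventually_ge p1)
    (eventually_and _ _ (eventually_Rpower_ge 4 e1 He1)
    (eventually_and _ _ (eventually_Rpower_ge (2 * (Rabs xi + 1)) (kap / 2) ltac:(lra))
    (eventually_and _ _ (eventually_Rpower_ge (1 + 2 * Rabs xi) (e1 / 2) ltac:(lra))
    (eventually_and _ _ (eventually_Rpower_ge (Rmax 2 p2) (sc / 2) ltac:(lra))
    (eventually_and _ _ (eventually_Rpower_ge 512 (2 * e1) ltac:(lra))
      (eventually_Rpower_ge (E * 2 ^ D) (kap / 2) ltac:(lra))))))))) as [x0 Hlarge].
  destruct (exists_nat_ge x0) as [n0 [_ Hn0]].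
  exists (2 * n0)%nat. intros N HN.
  set (P := Nat.div N 2).
  assert (HPN : (2 * P <= N <= 2 * P + 1)%nat).
  { unfold P. generalize (Nat.div_mod N 2 ltac:(lia)) (Nat.mod_upper_bound N 2 ltac:(lia)). lia. }
  assert (HP0 : x0 <= INR P) by (apply Rle_trans with (INR n0); [assumption|apply le_INR; lia]).
  destruct (Hlarge _ HP0) as [Hp3 [Hpp1 [HL1 [HL2 [HL3 [HL4 [HL5 HL6]]]]]]]. clear Hlarge HP0 Hn0.
  set (p := INR P) in *.
  assert (HNp : Rpower p (- (e1 / 2)) <= 1 * Rpower (INR N) (- (e1 / 4))).
  { assert (HN3 : INR N <= 3 * p).
    { destruct HPN as [_ H]. apply le_INR in H. rewrite plus_INR, mult_INR in H. simpl in H. fold p in H. lra. }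
    assert (HN1 : 1 <= INR N) by (change 1 with (INR 1); apply le_INR; assert (3 <= INR P) by assumption; destruct P; [simpl in *; lra|lia]).
    rewrite Rmult_1_l. replace (- (e1 / 2)) with (2 * - (e1 / 4)) by field. rewrite <- Rpower_mult.
    apply Rpower_anti; [|lra].
    replace 2 with (INR 2) by reflexivity. rewrite Rpower_pow by lra. nra. }
  set (eps := Rpower p (- e1)).
  assert (Heps0 : 0 < eps) by apply Rpower_pos.
  set (X := Rpower p (2 * e1)) in *.
  assert (HeX : 2 / (eps * eps) = 2 * X).
  { unfold eps, X. rewrite Rpower_Ropp. replace (2 * e1) with (e1 + e1) by ring. rewrite Rpower_plus.
    field. generalize (Rpower_pos p e1); lra. }
  destruct (classic (forall u v : Z, Rabs (IZR u) <= 2 * X -> Rabs (IZR v) <= 2 * X -> (u <> 0 \/ v <> 0)%Z ->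
     Rpower p (- kap) <= Rabs (IZR u * xi + IZR v * 1))) as [Hgen|Hspec].
  (* Centring the second coordinate at [eps] makes [F] exceed the integer [z'] by less than [2 eps],
     so its floor is [z']. *)
  - destruct (Hap P Hpp1 eps) with (b1 := xi) (b2 := 1) (s := 0) (t := eps) as [n [z [z' [Hn [Hz Hz']]]]].
    + fold p; split; [apply Rle_Rpower; unfold e1; lra|].
      unfold eps; rewrite Rpower_Ropp. apply Rinv_le_contravar; lra.
    + rewrite HeX; fold p. intros u v Hu Hv Huv. split; [apply Hgen; assumption|].
      eapply Rle_trans; [apply Rabs_triang|]. rewrite !Rabs_mult, Rabs_R1.
      apply Rle_trans with (2 * (Rabs xi + 1) * X).
      * generalize (Rabs_pos xi); nra.
      * replace kap with (kap / 2 + kap / 2) by field. rewrite Rpower_plus.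
        apply Rmult_le_compat; [generalize (Rabs_pos xi); lra|left; apply Rpower_pos|assumption|].
        apply Rle_Rpower; unfold e1; lra.
    + exists n. split; [destruct P; [simpl in *; unfold p in Hp3; simpl in Hp3; lra|lia]|]. split; [lia|].
      set (F := pseudo_poly d alpha theta (INR n)) in *.
      assert (He4 : eps <= / 4) by (unfold eps; rewrite Rpower_Ropp; apply Rinv_le_contravar; lra).
      apply Rabs_def2 in Hz'.
      rewrite (rfloor_unique F z') by lra.
      eapply Rle_trans; [apply (dist_nint_le _ z)|]. eapply Rle_trans; [|exact HNp].
      replace (xi * IZR z' - IZR z) with ((xi * F - 0 - IZR z) + - (xi * (F - IZR z'))) by ring.
      eapply Rle_trans; [apply Rabs_triang|]. rewrite Rabs_Ropp, Rabs_mult, (Rabs_right (F - IZR z')) by lra.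
      apply Rle_trans with ((1 + 2 * Rabs xi) * eps).
      * assert (Rabs xi * (F - IZR z') <= Rabs xi * (2 * eps)) by (apply Rmult_le_compat_l; [apply Rabs_pos|lra]). lra.
      * apply Rle_trans with (Rpower p (e1 / 2) * eps); [apply Rmult_le_compat_r; lra|].
        unfold eps; rewrite <- Rpower_plus. apply Rle_Rpower; lra.
  (* The failing pair has [u <> 0], since otherwise [|v| >= 1] would be below [p^(-kap) <= 1]; up to
     sign [u] is the denominator. *)
  - assert (Hq : exists q v : Z, (1 <= q)%Z /\ IZR q <= 2 * X /\ Rabs (IZR q * xi + IZR v) < Rpower p (- kap)).
    { apply not_all_ex_not in Hspec. destruct Hspec as [u Hspec]. apply not_all_ex_not in Hspec.
      destruct Hspec as [v Hspec]. apply imply_to_and in Hspec. destruct Hspec as [Hu Hspec].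
      apply imply_to_and in Hspec. destruct Hspec as [Hv Hspec]. apply imply_to_and in Hspec.
      destruct Hspec as [Huv Hspec]. apply Rnot_le_lt in Hspec. rewrite Rmult_1_r in Hspec.
      apply Rabs_le_elim in Hu.
      destruct (Z.lt_trichotomy u 0) as [Hu0|[->|Hu0]].
      - exists (- u)%Z, (- v)%Z. rewrite !opp_IZR. repeat split; [lia|lra|].
        replace (- IZR u * xi + - IZR v) with (- (IZR u * xi + IZR v)) by ring. rewrite Rabs_Ropp; assumption.
      - exfalso. rewrite Rmult_0_l, Rplus_0_l, <- abs_IZR in Hspec.
        assert (1 <= IZR (Z.abs v)) by (apply IZR_le; lia).
        assert (Rpower p (- kap) <= 1).
        { rewrite <- (Rpower_O p) by lra. apply Rle_Rpower; lra. } lra.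
      - exists u, v. repeat split; [lia|lra|assumption]. }
    destruct Hq as [q [v [Hq1 [HqX Hqv]]]].
    assert (Hsc2 : forall e, 0 <= e -> 1 <= Rpower p e).
    { intros e He. rewrite <- (Rpower_O p) by lra. apply Rle_Rpower; lra. }
    destruct (exists_nat_floor (Rpower p sc)) as [W [HW1 [HWu [HWl _]]]]; [apply Hsc2; lra|].
    assert (HWl' : Rpower p (sc / 2) <= INR W).
    { eapply Rle_trans; [|exact HWl]. replace sc with (sc / 2 + sc / 2) at 2 by field. rewrite Rpower_plus.
      assert (2 <= Rpower p (sc / 2)) by (eapply Rle_trans; [apply Rmax_l|exact HL4]). nra. }
    assert (HWP : (W <= P)%nat).
    { apply INR_le. eapply Rle_trans; [exact HWu|]. fold p. rewrite <- (Rpower_1 p) at 2 by lra. apply Rle_Rpower; lra. }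
    destruct (Hmul W) with (q := q) as [n [z [Hn Hz]]].
    + apply Rle_trans with (Rpower p (sc / 2)); [|assumption]. eapply Rle_trans; [apply Rmax_r|exact HL4].
    + assumption.
    + apply Rle_trans with (Rpower (Rpower p (sc / 2)) del).
      2:{ apply Rle_Rpower_l; [lra|]. split; [apply Rpower_pos|assumption]. }
      (* [64 q^3 <= 512 X^3], and [X >= 512]. *)
      rewrite Rpower_mult. apply Rle_trans with (X ^ 4).
      * apply IZR_le in Hq1. apply Rle_trans with (64 * (2 * X) ^ 3).
        -- apply Rmult_le_compat_l; [lra|]. apply pow_incr; lra.
        -- replace (64 * (2 * X) ^ 3) with (X ^ 3 * 512) by ring. replace (X ^ 4) with (X ^ 3 * X) by ring.
           apply Rmult_le_compat_l; [apply pow_le; lra|assumption].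
      * unfold X. rewrite Rpower_pow_mult. apply Rle_Rpower; [lra|]. simpl INR. unfold e1. lra.
    + exists n. split; [lia|]. split; [lia|]. rewrite Hz.
      (* With floor [q z], the distance to [- v z] is exactly [|q xi + v| * |z|]. *)
      eapply Rle_trans; [apply (dist_nint_le _ (- (v * z)))|]. eapply Rle_trans; [|exact HNp].
      rewrite opp_IZR, mult_IZR.
      replace (xi * (IZR q * IZR z) - - (IZR v * IZR z)) with ((IZR q * xi + IZR v) * IZR z) by ring.
      rewrite Rabs_mult.
      assert (Hn1 : 1 <= INR n) by (change 1 with (INR 1); apply le_INR; lia).
      destruct (Hf (INR n) Hn1) as [Hf0 Hf1].
      set (F := pseudo_poly d alpha theta (INR n)) in *.
      apply IZR_le in Hq1.
      assert (Hz0 : -1 < IZR q * IZR z <= F).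
      { rewrite <- Hz; unfold rfloor. destruct (base_Int_part F); lra. }
      assert (Hzpos : 0 <= IZR z).
      { apply IZR_le. assert (-1 < q * z)%Z by (apply lt_IZR; rewrite mult_IZR; simpl; lra).
        apply le_IZR in Hq1. nia. }
      assert (HzF : IZR z <= F) by nra.
      rewrite (Rabs_right (IZR z)) by lra.
      assert (HFb : F <= E * 2 ^ D * Rpower p (kap / 4)).
      { eapply Rle_trans; [exact Hf1|]. rewrite Rmult_assoc. apply Rmult_le_compat_l; [lra|].
        apply Rle_trans with (Rpower (2 * Rpower p sc) (INR D)).
        - apply Rle_Rpower_l; [lra|]. split; [lra|].
          assert (INR n <= 2 * INR W) by (replace (2 * INR W) with (INR (2 * W)) by (rewrite mult_INR; reflexivity); apply le_INR; lia).
          lra.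
        - rewrite <- Rpower_mult_distr by (try apply Rpower_pos; lra). rewrite Rpower_pow, Rpower_mult, HscD by lra.
          apply Rmult_le_compat_l; [apply pow_le; lra|]. apply Rle_Rpower; lra. }
      (* [p^(kap/2)] absorbs [E * 2^D] and [p^(kap/4)] bounds [p^(sc D)]; the remaining [p^(-kap/4)]
         is below [p^(-e1/2)]. *)
      apply Rle_trans with (Rpower p (- kap) * (Rpower p (kap / 2) * Rpower p (kap / 4))).
      * apply Rmult_le_compat; [apply Rabs_pos|assumption|lra|].
        eapply Rle_trans; [exact HzF|]. eapply Rle_trans; [exact HFb|].
        apply Rmult_le_compat_r; [left; apply Rpower_pos|assumption].
      * rewrite <- !Rpower_plus. apply Rle_Rpower; [lra|]. unfold e1; lra.
Qed.
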